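(* The frame of a $3\times3\times3$ cube can always be completed given any collection of $24$ colored cubes (arbitrary varieties, repetitions allowed). Consequently $\mathrm{fr}(3)=24$.
   Context: Fix a palette of six colors. A colored cube is a unit cube each of whose six faces is painted with a single color, every one of the six colors appearing on some face. Two colored cubes are of the same variety if one can be rigidly rotated onto the other with colors matching; there are exactly $30$ varieties. The frame of an $n\times n\times n$ cube consists of the $12n-16$ unit positions lying on its edges (corners included); building (completing) a frame means placing colored cubes into all these positions so that, on each of the six outer faces of the big cube, all visible unit faces have one common color. $\mathrm{fr}(n)$ denotes the smallest number $N$ such that from any collection of $N$ colored cubes (of arbitrary varieties, with repetition) one can select cubes to build an $n\times n\times n$ frame. *)

(* Defs.v *)
From HB Require Import structures.
From mathcomp Require Import all_boot all_order all_algebra all_fingroup.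

Set Implicit Arguments.
Unset Strict Implicit.
Unset Printing Implicit Defensive.

Import GRing.Theory.

Local Open Scope ring_scope.

Definition color : finType := 'I_6.

(** The face [(a, b)] of an axis-parallel cube is the one orthogonal to the axis
    [a], on the side of large coordinates if [b = true] and of small coordinates
    if [b = false]. *)
Definition face : finType := ('I_3 * bool)%type.

Definition colored_cube : finType :=
  {p : {ffun face -> color} | [forall c, [exists f, p f == c]]}.

Definition paint (q : colored_cube) : face -> color := val q.

(** The isometries of a centred cube are the signed permutations of the axes:
    [(s, e)] maps the basis vector of axis [a] to the one of axis [s a],
    reversed when [e a = true]. The rotations are those of determinant 1. *)
Definition isometry_mx (r : 'S_3 * {ffun 'I_3 -> bool}) : 'M[int]_3 :=
  diag_mx (\row_a (-1) ^+ r.2 a) *m perm_mx r.1.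

Definition rotation : finType :=
  {r : 'S_3 * {ffun 'I_3 -> bool} | \det (isometry_mx r) == 1}.

Definition rotate (r : rotation) (f : face) : face :=
  ((val r).1 f.1, f.2 (+) (val r).2 f.1).

Definition position (n : nat) : finType := {ffun 'I_3 -> 'I_n}.

Definition on_face (n : nat) (x : position n) (f : face) : bool :=
  x f.1 == (if f.2 then n.-1 else 0)%N :> nat.

(** An edge of the big cube is the intersection of two non-parallel faces. *)
Definition frame (n : nat) : {set position n} :=
  [set x | [exists f : face, exists g : face,
              [&& f.1 != g.1, on_face x f & on_face x g]]].

(** Collections are indexed families, so that repetitions are allowed. The unit
    cube chosen for the position [x] is number [sel x], turned by [rot x]; its
    face [g] then points in the direction [rotate (rot x) g]. The six outer faces
    of the big cube carry six different colors, as on a unit cube, so their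
    colors form a [colored_cube]; without this requirement opposite outer faces
    could share a color. *)
Definition frame_buildable (N n : nat) (c : 'I_N -> colored_cube) : Prop :=
  exists (big : colored_cube) (sel : position n -> 'I_N)
         (rot : position n -> rotation),
    {in frame n &, injective sel} /\
    forall (x : position n) (g : face), x \in frame n ->
      on_face x (rotate (rot x) g) ->
      paint (c (sel x)) g = paint big (rotate (rot x) g).

Definition frame_always_buildable (n N : nat) : Prop :=
  forall c : 'I_N -> colored_cube, frame_buildable n c.

Definition is_fr (n N : nat) : Prop :=
  frame_always_buildable n N /\
  forall M : nat, frame_always_buildable n M -> (N <= M)%N.

(* Main.v *)
From mathcomp Require Import all_boot all_algebra all_fingroup zify.
Require Import Defs.

Set Implicit Arguments.
Unset Strict Implicit.
Unset Printing Implicit Defensive.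

(** A cube of variety [V] other than the variety [T] of the big cube shares
    either no corner or exactly two corners with [T]. So the cubes at hand form a
    multigraph on the eight corners of [T], and by Hall's theorem the corners can
    be filled iff the number of tree components is at most the number of cubes
    of variety [T]. A collection is stuck if this fails for every coloring of the
    big cube. A variety with at least two cubes is heavy: it kills all tree
    components that it touches. Up to permutations of the colors only 143 sets of
    heavy varieties do not by themselves make some coloring fillable, and for each
    of them a bounded search over the varieties with one cube shows that a stuck
    collection has at most 23 cubes. A cube fits on an edge unless the two colors
    of the edge are opposite on it, so with 24 cubes edges can obstruct only if at
    least 16 cubes share a pair of opposite colors or at least 14 share two such
    pairs, and then a big cube of one of these varieties works. Conversely, take
    five varieties that pairwise share no corner, with multiplicities 7, 7, 7, 1,
    1: these 23 cubes are stuck. *)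

Local Ltac compute_true := vm_cast_no_check (erefl true).

(** * Sequences *)

Lemma all_iotaP (P : pred nat) n :
  reflect (forall k, k < n -> P k) (all P (iota 0 n)).
Proof.
apply: (iffP allP) => [allP k lt_kn | allP k]; last by rewrite mem_iota => /allP.
by apply: allP; rewrite mem_iota.
Qed.

Lemma all_iota2P (P : nat -> nat -> bool) m n :
  reflect (forall i j, i < m -> j < n -> P i j)
    (all (fun i => all (P i) (iota 0 n)) (iota 0 m)).
Proof.
apply: (iffP (all_iotaP _ m)) => [allP i j /allP/all_iotaP|allP i lt_i]; first exact.
by apply/all_iotaP => j; apply: allP.
Qed.

Fixpoint subseqs (T : Type) (s : seq T) : seq (seq T) :=
  if s is x :: s' then map (cons x) (subseqs s') ++ subseqs s' else [:: [::]].

Lemma mem_subseqs (T : eqType) (t s : seq T) : (t \in subseqs s) = subseq t s.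
Proof.
apply/idP/idP.
  elim: s t => [|x s IHs] t /=; first by rewrite inE => /eqP->.
  rewrite mem_cat => /orP[/mapP[t' /IHs sub ->]|/IHs sub]; first by rewrite /= eqxx.
  exact: subseq_trans sub (subseq_cons s x).
elim: s t => [|x s IHs] [|y t] //=; rewrite mem_cat.
  by rewrite (IHs [::]) ?sub0seq ?orbT.
by case: eqP => [-> /IHs t_in|_ /IHs->]; rewrite ?orbT ?map_f.
Qed.

Lemma subseq_cat_split (T : eqType) (s t1 t2 : seq T) : subseq s (t1 ++ t2) ->
  exists s1 s2, [/\ s = s1 ++ s2, subseq s1 t1 & subseq s2 t2].
Proof.
case/subseqP=> m sz_m ->; rewrite -(cat_take_drop (size t1) m) mask_cat; last first.
  by rewrite size_takel // sz_m size_cat leq_addr.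
set m1 := take _ _; set m2 := drop _ _.
by exists (mask m1 t1), (mask m2 t2); split=> //; apply: mask_subseq.
Qed.

Lemma sub_in_count (T : eqType) (P Q : pred T) (s : seq T) :
  {in s, subpred P Q} -> count P s <= count Q s.
Proof.
move=> sub_PQ; rewrite (@eq_in_count _ P (predI P Q)) => [|x /sub_PQ sub_x].
  by apply: sub_count => x /andP[].
by rewrite /= andb_idr.
Qed.

Lemma leq_count_of_count_mem (T : eqType) (P : pred T) (s t : seq T) :
  (forall x, count_mem x s <= count_mem x t) -> count P s <= count P t.
Proof. by case/count_subseqP=> t' sub_t /seq.permP->; apply: leq_count_subseq. Qed.

Lemma count_mem_gt0 (T : eqType) (s : seq T) x : (0 < count_mem x s) = (x \in s).
Proof. by rewrite -has_count has_pred1. Qed.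

Lemma leq_count_mem_map (T1 T2 : eqType) (f : T1 -> T2) (s : seq T1) x :
  count_mem x s <= count_mem (f x) (map f s).
Proof. by rewrite count_map; apply: sub_count => y /= /eqP->. Qed.

Lemma sum_count_mem (T : eqType) (t s : seq T) : uniq t ->
  \sum_(x <- t) count_mem x s = count [in t] s.
Proof.
move=> uniq_t; elim: s => [|y s IHs] /=; first by rewrite big1.
rewrite big_split /= IHs; congr (_ + _); rewrite -(count_uniq_mem y uniq_t) -sum1_count.
by rewrite [RHS]big_mkcond; apply: eq_bigr => x _; rewrite /= eq_sym; case: eqP.
Qed.

Lemma leq_sum_count_mem (T : eqType) (P : pred T) (t s : seq T) : uniq t ->
  \sum_(x <- t) P x * count_mem x s <= count P s.
Proof.
move=> uniq_t; under eq_bigr do rewrite mulnbl.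
rewrite -big_mkcond -big_filter sum_count_mem ?filter_uniq //.
by apply: sub_count => x; rewrite /= mem_filter => /andP[].
Qed.

Lemma leq_count_has (T : Type) (P : pred T) (s : seq T) : count P s <= size s * has P s.
Proof. by rewrite has_count; case: posnP => [->|_] //; rewrite muln1 count_size. Qed.

Lemma leq_foldr_maxn (s : seq nat) n : n \in s -> n <= foldr maxn 0 s.
Proof.
elim: s => //= m s IHs; rewrite inE leq_max.
by case/orP=> [/eqP->|/IHs->]; rewrite ?leqnn ?orbT.
Qed.

(** * Hall's theorem *)

Section Hall.

Variables X Y : finType.
Implicit Types (r : X -> Y -> bool) (A D : {set X}) (B : {set Y}) (f g : X -> Y).

Definition neighbors r A : {set Y} := [set y | [exists x in A, r x y]].

Definition hall r D : Prop := forall A, A \subset D -> #|A| <= #|neighbors r A|.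

Definition matching r D f : Prop :=
  {in D &, injective f} /\ {in D, forall x, r x (f x)}.

Definition avoid r B : X -> Y -> bool := fun x y => r x y && (y \notin B).

Lemma neighborsP r A y : reflect (exists2 x, x \in A & r x y) (y \in neighbors r A).
Proof. by rewrite inE; apply: exists_inP. Qed.

Lemma neighborsU r A1 A2 : neighbors r (A1 :|: A2) = neighbors r A1 :|: neighbors r A2.
Proof.
apply/setP=> y; rewrite in_setU; apply/neighborsP/orP => [[x]|].
  by rewrite in_setU => /orP[] x_in r_xy; [left | right]; apply/neighborsP; exists x.
by case=> /neighborsP[x x_in r_xy]; exists x; rewrite // in_setU x_in ?orbT.
Qed.

Lemma neighbors_avoid r B A : neighbors (avoid r B) A = neighbors r A :\: B.
Proof.
apply/setP=> y; rewrite in_setD; apply/neighborsP/andP => [[x A_x /andP[r_xy notB]]|].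
  by split=> //; apply/neighborsP; exists x.
by case=> notB /neighborsP[x A_x r_xy]; exists x; rewrite // /avoid r_xy.
Qed.

Lemma matching_hall r D f : matching r D f -> hall r D.
Proof.
case=> inj_f r_f A sub_A; rewrite -(card_in_imset (sub_in2 (subsetP sub_A) inj_f)).
apply/subset_leq_card/subsetP => _ /imsetP[x A_x ->]; apply/neighborsP; exists x => //.
exact/r_f/(subsetP sub_A).
Qed.

Lemma matching_glue r D A B f g : matching r A f -> {in A, forall x, f x \in B} ->
  matching (avoid r B) (D :\: A) g ->
  matching r D (fun x => if x \in A then f x else g x).
Proof.
move=> [inj_f r_f] f_B [inj_g r_g].
have g_avoid x : x \in D -> x \notin A -> r x (g x) && (g x \notin B).
  by move=> D_x notA; apply: r_g; rewrite inE notA.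
split=> [x y D_x D_y|x D_x]; last first.
  by case: ifPn => [/r_f //|/(g_avoid x D_x)/andP[]].
case: ifPn => A_x; case: ifPn => A_y eq_xy.
- exact: inj_f.
- by have /andP[_] := g_avoid y D_y A_y; rewrite -eq_xy f_B.
- by have /andP[_] := g_avoid x D_x A_x; rewrite eq_xy f_B.
by apply: inj_g; rewrite // inE ?A_x ?A_y.
Qed.

Lemma hall_sub r D A : hall r D -> A \subset D -> hall r A.
Proof. by move=> hall_D sub_A A' sub_A'; apply/hall_D/(subset_trans sub_A'). Qed.

Lemma hall_tight r D A : hall r D -> A \subset D -> #|neighbors r A| <= #|A| ->
  hall (avoid r (neighbors r A)) (D :\: A).
Proof.
move=> hall_D sub_A tight A'; rewrite subsetD => /andP[sub_A' disj_A'].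
have := hall_D (A :|: A'); rewrite subUset sub_A sub_A' => /(_ isT).
rewrite neighborsU neighbors_avoid !cardsU cardsD [A :&: A']setIC.
rewrite (disjoint_setI0 disj_A') cards0 [neighbors r A :&: _]setIC.
have := subset_leq_card (subsetIl (neighbors r A') (neighbors r A)); lia.
Qed.

Lemma hall_loose r D x y : x \in D ->
  (forall A, A \proper D -> A != set0 -> #|A| < #|neighbors r A|) ->
  hall (avoid r [set y]) (D :\ x).
Proof.
move=> D_x loose A; rewrite subsetD1 => /andP[sub_A notA_x].
have [->|A_neq0] := eqVneq A set0; first by rewrite cards0.
have /loose/(_ A_neq0) : A \proper D.
  by rewrite properE sub_A; apply: contra notA_x => /subsetP; apply.
by rewrite neighbors_avoid (cardsD1 y (neighbors r A)); case: (y \in _) => /=; lia.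
Qed.

Lemma matching_exists r D (y0 : Y) : hall r D -> exists f, matching r D f.
Proof.
have [n] := ubnP #|D|; elim: n r D => // n IHn r D; rewrite ltnS => le_D hall_D.
have [->|[x D_x]] := set_0Vmem D; first by exists (fun=> y0); split=> x; rewrite inE.
have [/existsP[A /and3P[prop_A A_neq0 tight]]|/existsPn no_tight] := boolP
    [exists A : {set X}, [&& A \proper D, A != set0 & #|neighbors r A| <= #|A|]].
  have sub_A := proper_sub prop_A.
  have [f match_f] : exists f, matching r A f.
    by apply: IHn (hall_sub hall_D sub_A); apply: leq_trans (proper_card prop_A) le_D.
  have [|g match_g] := IHn _ (D :\: A) _ (hall_tight hall_D sub_A tight).
    apply: leq_trans le_D; rewrite cardsD (setIidPr sub_A).
    by rewrite -card_gt0 in A_neq0; have := subset_leq_card sub_A; lia.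
  exists (fun z => if z \in A then f z else g z).
  apply: (matching_glue match_f _ match_g).
  by move=> z A_z; apply/neighborsP; exists z => //; case: match_f => _; apply.
have loose A : A \proper D -> A != set0 -> #|A| < #|neighbors r A|.
  by move=> prop_A A_neq0; have := no_tight A; rewrite prop_A A_neq0 ltnNge.
have [y r_xy] : exists y, r x y.
  have /card_gt0P[y /neighborsP[z]] : 0 < #|neighbors r [set x]|.
    by apply: leq_trans (hall_D [set x] _); rewrite ?cards1 ?sub1set.
  by rewrite inE => /eqP-> r_xy; exists y.
have [|g match_g] := IHn _ (D :\ x) _ (hall_loose y D_x loose).
  by rewrite (cardsD1 x) D_x in le_D.
exists (fun z => if z \in [set x] then y else g z).
apply: (matching_glue (f := fun=> y)) match_g => [|z _]; last by rewrite inE.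
by split=> [z z' /set1P-> /set1P->|z /set1P->].
Qed.

End Hall.

(** * Permutations as sequences of values *)

(* A sequence [s] of length [n] stands for the map [nth 0 s] on [iota 0 n]. *)
Definition is_perm (n : nat) (s : seq nat) : bool := perm_eq s (iota 0 n).
Definition compose (s t : seq nat) : seq nat := [seq nth 0 s i | i <- t].
Definition inverse (s : seq nat) : seq nat := [seq index i s | i <- iota 0 (size s)].

Lemma nth_compose s t i : i < size t -> nth 0 (compose s t) i = nth 0 s (nth 0 t i).
Proof. exact: nth_map. Qed.

Lemma composeA s t u : all (gtn (size t)) u ->
  compose s (compose t u) = compose (compose s t) u.
Proof.
move/allP=> u_lt; rewrite /compose -map_comp; apply/eq_in_map => i /u_lt lt_i /=.
by rewrite (nth_map 0).
Qed.

Section IsPerm.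

Variables (n : nat) (s : seq nat).
Hypothesis s_perm : is_perm n s.

Lemma is_perm_size : size s = n.
Proof. by rewrite (perm_size s_perm) size_iota. Qed.

Lemma is_perm_uniq : uniq s.
Proof. by rewrite (perm_uniq s_perm) iota_uniq. Qed.

Lemma mem_is_perm i : (i \in s) = (i < n).
Proof. by rewrite (perm_mem s_perm) mem_iota. Qed.

Lemma is_perm_lt i : i < n -> nth 0 s i < n.
Proof. by move=> lt_i; rewrite -mem_is_perm mem_nth ?is_perm_size. Qed.

Lemma all_is_perm : all (gtn n) s.
Proof. by apply/allP => i; rewrite mem_is_perm. Qed.

Lemma compose_iota : compose s (iota 0 n) = s.
Proof. by rewrite /compose -is_perm_size map_nth_iota0 // take_size. Qed.

Lemma iota_compose : compose (iota 0 n) s = s.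
Proof.
rewrite -[RHS]map_id; apply/eq_in_map => i; rewrite mem_is_perm => lt_i.
by rewrite nth_iota.
Qed.

Lemma nth_inverse i : i < n -> nth 0 (inverse s) i = index i s.
Proof.
by move=> lt_i; rewrite (nth_map 0) ?nth_iota ?size_iota ?is_perm_size.
Qed.

Lemma compose_inverse : compose s (inverse s) = iota 0 n.
Proof.
rewrite /compose -map_comp -[RHS]map_id is_perm_size; apply/eq_in_map => i.
by rewrite mem_iota -mem_is_perm /= => /nth_index->.
Qed.

Lemma inverse_compose : compose (inverse s) s = iota 0 n.
Proof.
apply: (@eq_from_nth _ 0) => [|i]; rewrite size_map is_perm_size ?size_iota // => lt_i.
rewrite nth_compose ?nth_inverse ?is_perm_lt ?is_perm_size //.
by rewrite nth_iota // index_uniq ?is_perm_size ?is_perm_uniq.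
Qed.

Lemma compose_perm t : is_perm n t -> is_perm n (compose s t).
Proof.
move/(perm_map (nth 0 s)); rewrite -/(compose s t) -/(compose s _) compose_iota.
by move/perm_trans; apply.
Qed.

End IsPerm.

Lemma inverse_perm n s : is_perm n s -> is_perm n (inverse s).
Proof.
move=> s_perm; have := perm_map (index^~ s) s_perm; rewrite /is_perm perm_sym.
suff ->: [seq index i s | i <- s] = iota 0 n by rewrite /inverse (is_perm_size s_perm).
rewrite -(inverse_compose s_perm); apply/eq_in_map => i.
by rewrite (mem_is_perm s_perm) => /(nth_inverse s_perm)->.
Qed.

(** * Cubes, corners and edges as tables *)

(* A coloring lists the colors of the faces; the face orthogonal to the axis [a]
   on the side [b] has index [2 * a + b]. *)
Definition coloring (p : seq nat) : bool := is_perm 6 p.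
Definition colorings : seq (seq nat) := Eval vm_compute in permutations (iota 0 6).

Lemma mem_colorings p : (p \in colorings) = coloring p.
Proof.
have ->: colorings = permutations (iota 0 6) by vm_cast_no_check (erefl colorings).
exact: mem_permutations.
Qed.

Lemma all_coloringsP (P : pred (seq nat)) : all P colorings -> forall p, coloring p -> P p.
Proof. by move/allP=> allP p; rewrite -mem_colorings => /allP. Qed.

(* The positions of the frame that lie on [k] outer faces, given by these faces. *)
Definition cells (k : nat) : seq (seq nat) :=
  [seq d <- subseqs (iota 0 6) | (size d == k) && uniq [seq f./2 | f <- d]].

Definition corners : seq (seq nat) := Eval vm_compute in cells 3.
Definition edges : seq (seq nat) := Eval vm_compute in cells 2.
Definition corner (k : nat) : seq nat := nth [::] corners k.

Lemma cells_lt d : d \in corners ++ edges -> all (gtn 6) d.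
Proof. by move: d; apply/allP; compute_true. Qed.

Definition axis_values : seq (seq nat * bool) :=
  [:: ([:: 0; 1; 2], false); ([:: 0; 2; 1], true); ([:: 1; 0; 2], true);
      ([:: 2; 1; 0], true); ([:: 1; 2; 0], false); ([:: 2; 0; 1], false)].

Definition reversals : seq (seq bool) :=
  [seq [:: a; bc.1; bc.2] | a <- [:: false; true],
     bc <- [:: (false, false); (false, true); (true, false); (true, true)]].

(* The side [b] of the axis [a] moves to the side [b (+) e_a] of the axis [s_a]. *)
Definition face_values (s : seq nat) (e : seq bool) : seq nat :=
  flatten [seq [:: 2 * nth 0 s a + nth false e a; 2 * nth 0 s a + ~~ nth false e a]
             | a <- iota 0 3].

Definition rotations : seq (seq nat) :=
  Eval vm_compute in
  [seq face_values sb.1 e | sb <- axis_values,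
     e <- [seq e <- reversals | odd (count id e) == sb.2]].

Lemma rotationsE : rotations =
  [seq face_values sb.1 e | sb <- axis_values,
     e <- [seq e <- reversals | odd (count id e) == sb.2]].
Proof. by []. Qed.

Lemma rotation_coloring u : u \in rotations -> coloring u.
Proof. by move: u; apply/allP; compute_true. Qed.

Lemma rotation_compose u v : u \in rotations -> v \in rotations ->
  compose u v \in rotations.
Proof.
move=> u_rot; have: all (fun u => all (fun v => compose u v \in rotations) rotations)
  rotations by compute_true.
by move/allP/(_ u u_rot)/allP; apply.
Qed.

Lemma rotation_inverse u : u \in rotations -> inverse u \in rotations.
Proof. by move: u; apply/allP; compute_true. Qed.

(* The rotation whose inverse is [u] turns a cube painted [p] so that it shows the
   colors of [q] on the faces [d]. *)
Definition placeable (p q d : seq nat) : bool :=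
  has (fun u => all (fun g => nth 0 p (nth 0 u g) == nth 0 q g) d) rotations.

Lemma placeable_rotate p q d u : coloring p -> u \in rotations -> all (gtn 6) d ->
  placeable (compose p u) q d = placeable p q d.
Proof.
have turn p' v : coloring p' -> v \in rotations -> all (gtn 6) d ->
    placeable (compose p' v) q d -> placeable p' q d.
  move=> p'_col v_rot /allP lt_d /hasP[w w_rot /allP w_ok].
  apply/hasP; exists (compose v w); first exact: rotation_compose.
  apply/allP => g d_g; rewrite -(eqP (w_ok g d_g)).
  have w_col := rotation_coloring w_rot.
  have lt_g : g < 6 := lt_d g d_g.
  rewrite !nth_compose ?(is_perm_size w_col) //.
  by rewrite (is_perm_size (rotation_coloring v_rot)) (is_perm_lt w_col).
move=> p_col u_rot lt_d; have u_col := rotation_coloring u_rot.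
apply/idP/idP; first exact: (turn p u).
rewrite -[p in X in X -> _](compose_iota p_col) -(compose_inverse u_col).
rewrite composeA ?(is_perm_size u_col); last exact: all_is_perm (inverse_perm u_col).
by apply: (turn _ _ _ _ lt_d); [apply: compose_perm | apply: rotation_inverse].
Qed.

Lemma placeable_recolor s p q d : coloring s -> coloring p -> coloring q ->
  all (gtn 6) d -> placeable p q d -> placeable (compose s p) (compose s q) d.
Proof.
move=> s_col p_col q_col /allP lt_d /hasP[u u_rot /allP u_ok].
apply/hasP; exists u => //; apply/allP => g d_g; have lt_g : g < 6 := lt_d g d_g.
have u_col := rotation_coloring u_rot.
rewrite !nth_compose ?(is_perm_size p_col) ?(is_perm_size q_col) ?(is_perm_lt u_col) //.
by rewrite (eqP (u_ok g d_g)).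
Qed.

(* Each variety contains exactly one reduced coloring. *)
Definition reduced (p : seq nat) : bool :=
  (nth 0 p 0 == 0) && (nth 0 p 2 == if nth 0 p 1 == 1 then 2 else 1).

Definition varieties : seq (seq nat) := Eval vm_compute in filter reduced colorings.

Definition variety (V : nat) : seq nat := nth [::] varieties V.

Definition reducing_rotation (p : seq nat) : seq nat :=
  nth [::] rotations (find (fun u => reduced (compose p u)) rotations).

Definition variety_of (p : seq nat) : nat :=
  index (compose p (reducing_rotation p)) varieties.

Lemma variety_coloring V : V < 30 -> coloring (variety V).
Proof. by move: V; apply/all_iotaP; compute_true. Qed.

Lemma variety_of_lt p : coloring p -> variety_of p < 30.
Proof. by move: p; apply: all_coloringsP; compute_true. Qed.

Lemma variety_of_variety V : V < 30 -> variety_of (variety V) = V.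
Proof. by move=> lt_V; apply/eqP; move: V lt_V; apply/all_iotaP; compute_true. Qed.

Lemma reducing_rotationP p : coloring p -> reducing_rotation p \in rotations.
Proof. by move: p; apply: all_coloringsP; compute_true. Qed.

Lemma placeable_variety_of p q d : coloring p -> all (gtn 6) d ->
  placeable (variety (variety_of p)) q d = placeable p q d.
Proof.
move=> p_col lt_d; rewrite /variety nth_index -?index_mem ?variety_of_lt //.
exact: placeable_rotate (reducing_rotationP p_col) lt_d.
Qed.

(** * Fillable cells *)

Definition fits (q : seq nat) (D : seq (seq nat)) (V : nat) : bool :=
  has (placeable (variety V) q) D.

(* Hall's condition for filling the cells [cs] of a big cube painted [q] with cubes
   whose varieties are listed in [s]. *)
Definition fillable (cs : seq (seq nat)) (s q : seq nat) : Prop :=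
  forall D, subseq D cs -> size D <= count (fits q D) s.

Lemma leq_count_fits q D D' s : {subset D <= D'} ->
  count (fits q D) s <= count (fits q D') s.
Proof.
by move=> sub_D; apply: sub_count => V /hasP[d /sub_D D'_d fit]; apply/hasP; exists d.
Qed.

Lemma fillableP cs s q :
  reflect (fillable cs s q)
    (all (fun D => size D <= count (fits q D) s) (subseqs cs)).
Proof.
apply: (iffP allP) => fill D; last by rewrite mem_subseqs => /fill.
by rewrite -mem_subseqs => /fill.
Qed.

Definition stuck (s : seq nat) : Prop := forall q, coloring q -> ~ fillable corners s q.

Lemma stuck_or_fillable s : stuck s \/ exists2 q, coloring q & fillable corners s q.
Proof.
have [/hasP[q q_col /fillableP fill_q]|/hasPn no_q] := boolP (has (fun q =>
    all (fun D => size D <= count (fits q D) s) (subseqs corners)) colorings).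
  by right; exists q; rewrite -?mem_colorings.
by left=> q; rewrite -mem_colorings => /no_q/negP + /fillableP.
Qed.

(** * Shared corners *)

Definition shared_table : seq (seq (seq nat)) :=
  Eval vm_compute in
  [seq [seq [seq k <- iota 0 8 | placeable (variety V) (variety T) (corner k)]
          | T <- iota 0 30] | V <- iota 0 30].

Definition shared (V T : nat) : seq nat := nth [::] (nth [::] shared_table V) T.

Lemma sharedE V T : V < 30 -> T < 30 ->
  shared V T = [seq k <- iota 0 8 | placeable (variety V) (variety T) (corner k)].
Proof.
move=> lt_V lt_T; rewrite /shared.
have ->: shared_table =
    [seq [seq [seq k <- iota 0 8 | placeable (variety V) (variety T) (corner k)]
            | T <- iota 0 30] | V <- iota 0 30].
  by vm_cast_no_check (erefl shared_table).
by rewrite !(nth_map 0) ?size_iota // !nth_iota.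
Qed.

Lemma shared_self T : T < 30 -> shared T T = iota 0 8.
Proof. by move=> lt_T; apply/eqP; move: T lt_T; apply/all_iotaP; compute_true. Qed.

Lemma shared_lt V T : all (gtn 8) (shared V T).
Proof.
have: all (all (all (gtn 8))) shared_table by compute_true.
case: (ltnP V (size shared_table)) => [lt_V /allP/(_ _ (mem_nth [::] lt_V)) row_lt|].
  case: (ltnP T (size (nth [::] shared_table V))) => [lt_T|le_T].
    exact: (allP row_lt) _ (mem_nth [::] lt_T).
  by rewrite /shared nth_default.
by move=> le_V _; rewrite /shared [nth _ _ V]nth_default // nth_nil.
Qed.

Lemma size_corners D : subseq D corners ->
  size D = count (fun k => corner k \in D) (iota 0 8).
Proof.
move=> sub_D; have /subseq_uniqP {1}-> // := sub_D.
by rewrite size_filter -[X in count _ X]/(map corner (iota 0 8)) count_map.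
Qed.

Lemma fits_shared V T D : V < 30 -> T < 30 -> subseq D corners ->
  fits (variety T) D V = has (fun k => corner k \in D) (shared V T).
Proof.
move=> lt_V lt_T /mem_subseq sub_D; rewrite sharedE //; apply/hasP/hasP.
  case=> d D_d fit; exists (index d corners); rewrite /corner ?nth_index ?sub_D //.
  by rewrite mem_filter mem_iota /corner nth_index ?sub_D // fit index_mem sub_D.
by case=> k; rewrite mem_filter => /andP[fit _] D_k; exists (corner k).
Qed.

(** * Tree components *)

Definition touches (a b : nat) (K : seq nat) : bool := (a \in K) || (b \in K).

(* [ks] lists the tree components of a graph on the eight corners; a corner in no
   listed component lies in a component that contains a cycle. Distinct
   components are disjoint, so the last branch of the match is never taken. *)
Definition add_edge (e : seq nat) (ks : seq (seq nat)) : seq (seq nat) :=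
  if e is [:: a; b] then
    let rest := [seq K <- ks | ~~ touches a b K] in
    match [seq K <- ks | touches a b K] with
    | [::] | [:: _] => rest
    | [:: K1; K2] => (K1 ++ K2) :: rest
    | _ => ks
    end
  else ks.

Lemma count_add_edge (P : pred nat) (e : seq nat) ks :
  count (all P) ks <= count (all P) (add_edge e ks) + has P e.
Proof.
case: e => [|a [|b [|c e]]]; try exact: leq_addr.
rewrite /add_edge [has _ _]/= orbF; set touch := touches a b.
have: count (all P) [seq K <- ks | touch K] + count (all P) [seq K <- ks | ~~ touch K]
    = count (all P) ks.
  by rewrite -count_cat; apply/seq.permP; rewrite perm_filterC.
have [_ | /norP[Pa Pb]] := boolP (P a || P b).
  by case: [seq K <- ks | touch K] => [|K1 [|K2 [|]]] //=; rewrite ?all_cat; lia.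
have: count (all P) [seq K <- ks | touch K] = 0; last first.
  by case: [seq K <- ks | touch K] => [|K1 [|K2 [|]]] //=; rewrite ?all_cat; lia.
apply/eqP; rewrite -leqn0 leqNgt -has_count; apply/hasPn => K.
rewrite mem_filter => /andP[/orP[] K_end _]; apply/allPn.
  by exists a.
by exists b.
Qed.

(* The entry number [T] holds the number of cubes of variety [T] placed so far and
   the tree components of the graph on the corners of [T]. *)
Definition state : Type := seq (nat * seq (seq nat)).
Definition cubes (st : state) (T : nat) : nat := (nth (0, [::]) st T).1.
Definition trees (st : state) (T : nat) : seq (seq nat) := (nth (0, [::]) st T).2.

Definition state0 : state := nseq 30 (0, [seq [:: k] | k <- iota 0 8]).

Definition place (V : nat) (st : state) : state :=
  mkseq (fun T => (cubes st T + (T == V), add_edge (shared V T) (trees st T))) 30.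

Definition state_of (Vs : seq nat) : state := foldr place state0 Vs.

Definition dead (st : state) : bool := has (fun x => size x.2 <= x.1) st.

Lemma size_state_of Vs : size (state_of Vs) = 30.
Proof. by case: Vs => [|V Vs] //=; rewrite size_mkseq. Qed.

Lemma cubes_state_of Vs T : T < 30 -> cubes (state_of Vs) T = count_mem T Vs.
Proof.
move=> lt_T; elim: Vs => [|V Vs IHVs] /=; first by rewrite /cubes nth_nseq lt_T.
by rewrite {1}/cubes nth_mkseq //= IHVs addnC eq_sym.
Qed.

Lemma trees_state_of Vs T (P : pred nat) : T < 30 ->
  count P (iota 0 8) <= count (all P) (trees (state_of Vs) T)
                        + count (fun V => (V != T) && has P (shared V T)) Vs.
Proof.
move=> lt_T; elim: Vs => [|V Vs IHVs].
  rewrite /trees nth_nseq lt_T addn0 count_map; apply/eq_leq/eq_count => k /=.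
  by rewrite andbT.
rewrite /trees nth_mkseq //= -/(state_of Vs); apply: leq_trans IHVs _.
have [->|_] := eqVneq V T; first by rewrite shared_self.
by rewrite addnA leq_add2r; apply: count_add_edge.
Qed.

Section Stuck.

Variable s : seq nat.
Hypotheses (s_lt : all (gtn 30) s) (s_stuck : stuck s).

Lemma stuck_violation T : T < 30 -> exists P : pred nat,
  count_mem T s + count (fun V => (V != T) && has P (shared V T)) s
    < count P (iota 0 8).
Proof.
move=> lt_T; have /fillableP/allPn[D] := s_stuck (variety_coloring lt_T).
rewrite mem_subseqs -ltnNge => sub_D lt_D; pose P k := corner k \in D.
exists P; rewrite size_corners // -/P in lt_D; apply: leq_ltn_trans (lt_D).
have has_P : has P (iota 0 8) by rewrite has_count; apply: leq_ltn_trans lt_D.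
rewrite -count_predUI [X in _ + X](@eq_count _ _ pred0) => [|V /=]; last by case: eqP.
rewrite count_pred0 addn0; apply/eq_leq/eq_in_count => V s_V /=.
have lt_V : V < 30 := allP s_lt V s_V.
by rewrite fits_shared //; case: eqP => [->|]; rewrite ?shared_self.
Qed.

Lemma stuck_trees Vs T : (forall V, count_mem V Vs <= count_mem V s) -> T < 30 ->
  count_mem T s < size (trees (state_of Vs) T).
Proof.
move=> le_Vs lt_T; have [P lt_P] := stuck_violation lt_T.
have := leq_count_of_count_mem (fun V => (V != T) && has P (shared V T)) le_Vs.
have := count_size (all P) (trees (state_of Vs) T).
have := trees_state_of Vs P lt_T; lia.
Qed.

Lemma stuck_not_dead Vs : (forall V, count_mem V Vs <= count_mem V s) ->
  ~~ dead (state_of Vs).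
Proof.
move=> le_Vs; apply/hasPn => x /(nthP (0, [::]))[T]; rewrite size_state_of => lt_T <-.
rewrite -ltnNge -/(cubes _ T) cubes_state_of //.
by apply: leq_ltn_trans (le_Vs T) (stuck_trees le_Vs lt_T).
Qed.

End Stuck.

(** * The number of cubes of one variety *)

Definition misses (T : nat) (C : seq nat) : nat :=
  count (fun V => ~~ has [in C] (shared V T)) (iota 0 30).

Definition max_misses : seq nat :=
  Eval vm_compute in
  [seq foldr maxn 0 [seq misses T C | T <- iota 0 30,
                       C <- [seq C <- subseqs (iota 0 8) | size C == c]]
     | c <- iota 0 9].

(* A variety of a stuck collection with [n] varieties has at most [cap n] cubes: if a
   set of [c] corners is violated, at least [n.-1 - nth 0 max_misses c] other
   varieties share one of these corners. *)
Definition cap (n : nat) : nat :=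
  foldr maxn 0 [seq c.-1 - (n.-1 - nth 0 max_misses c) | c <- iota 1 8].

Lemma leq_misses T C : T < 30 -> subseq C (iota 0 8) ->
  misses T C <= nth 0 max_misses (size C).
Proof.
have: all (fun T => all (fun C => misses T C <= nth 0 max_misses (size C))
  (subseqs (iota 0 8))) (iota 0 30) by compute_true.
move/all_iotaP=> max_T lt_T sub_C; apply: (allP (max_T T lt_T)).
by rewrite mem_subseqs.
Qed.

Lemma leq_count_not_shared T (P : pred nat) : T < 30 ->
  count (fun V => ~~ has P (shared V T)) (iota 0 30)
    <= nth 0 max_misses (count P (iota 0 8)).
Proof.
move=> lt_T; rewrite -(size_filter P).
apply: leq_trans (leq_misses lt_T (filter_subseq _ _)).
apply/eq_leq/eq_count => V; congr (~~ _); apply: eq_in_has => k.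
move/(allP (shared_lt V T)) => lt_k; rewrite [RHS]mem_filter mem_iota.
by rewrite [X in _ && X]lt_k andbT.
Qed.

Lemma stuck_cap s T : all (gtn 30) s -> stuck s -> T < 30 ->
  count_mem T s <= cap (size (undup s)).
Proof.
move=> s_lt s_stuck lt_T; have [P] := stuck_violation s_lt s_stuck lt_T.
set other := fun V => _; set c := count P _ => lt_c.
have le_c8 : c <= 8 by rewrite -[leqRHS](size_iota 0) count_size.
have le_hit := count_undup s other.
have le_miss : count (predC other) (undup s) <= 1 + nth 0 max_misses c.
  apply: leq_trans (leq_add (leqnn 1) (leq_count_not_shared P lt_T)).
  have count_T : count_mem T (iota 0 30) = 1.
    by rewrite count_uniq_mem ?iota_uniq // mem_iota lt_T.
  rewrite -[X in X + _]count_T -count_predUI; apply: leq_trans (leq_addr _ _).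
  apply: leq_trans (_ : _ <= count (predC other) (iota 0 30)) _.
    apply/leq_count_of_count_mem/leq_uniq_count; rewrite ?undup_uniq // => V.
    by rewrite mem_undup mem_iota => /(allP s_lt).
  by apply: sub_count => V /=; rewrite negb_and negbK.
have c_in : c \in iota 1 8.
  by rewrite (mem_iota 1 8) ltnS le_c8 andbT; apply: leq_ltn_trans lt_c.
apply: leq_trans (leq_foldr_maxn (map_f _ c_in)).
have := count_predC other (undup s); lia.
Qed.

(** * Search through the varieties with one cube *)

(* A stuck collection has at most [(size (trees st V)).-1] cubes of variety [V], and
   its number of varieties lies between [h + l] and [h + l + f]. *)
Definition few_cubes (H : seq nat) (st : state) (l : nat) (free : seq nat) : bool :=
  let h := size H in
  let f := count (fun V => 1 < size (trees st V)) free in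
  all (fun n =>
         let M := cap n in
         (M == 0)
         || (sumn [seq minn (size (trees st V)).-1 M | V <- H] + (n - h) < 24))
    (iota (h + l) f.+1).

(* Nested conditionals, since [vm_compute] evaluates both sides of [||]. *)
Fixpoint light_search (H : seq nat) (st : state) (l : nat) (free : seq nat) : bool :=
  if dead st then true else if few_cubes H st l free then true else
  if free is V :: free' then
    (if 1 < size (trees st V) then light_search H (place V st) l.+1 free' else true)
    && light_search H st l free'
  else false.

Definition twice (H : seq nat) : seq nat := flatten [seq [:: V; V] | V <- H].

Lemma count_mem_twice H V : count_mem V (twice H) = (count_mem V H).*2.
Proof. by elim: H => //= W H ->; case: eqP => _; rewrite ?doubleD. Qed.

Record splits (s H L free : seq nat) : Prop := Splits {
  splits_uniq : uniq (H ++ L ++ free);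
  splits_heavy : forall V, (V \in H) = (1 < count_mem V s);
  splits_light : {subset L <= s};
  splits_all : {subset s <= H ++ L ++ free} }.

Lemma splits_count_mem s H L free V : splits s H L free ->
  V \in L ++ free -> count_mem V s = (V \in s).
Proof.
case=> + heavy _ _; rewrite cat_uniq => /and3P[_ /hasPn notH _] /notH.
by rewrite heavy -leqNgt -count_mem_gt0; case: (count_mem V s) => [|[]].
Qed.

Lemma splits_size_undup s H L free : splits s H L free ->
  size (undup s) = size H + count [in s] (L ++ free).
Proof.
case=> uniq_HLF heavy _ all_s.
have ->: size (undup s) = count [in s] (H ++ L ++ free).
  rewrite -size_filter; apply/perm_size/uniq_perm; rewrite ?undup_uniq ?filter_uniq //.
  by move=> V; rewrite mem_undup mem_filter andb_idr //; apply: all_s.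
rewrite count_cat; congr (_ + _); apply/eqP; rewrite -all_count; apply/allP => V.
by rewrite heavy /= -count_mem_gt0; apply: ltnW.
Qed.

Lemma splits_size s H L free : splits s H L free ->
  size s = \sum_(V <- H) count_mem V s + (size (undup s) - size H).
Proof.
move=> split_s; have [uniq_HLF _ _ all_s] := split_s.
have ->: size s = \sum_(V <- H ++ L ++ free) count_mem V s.
  by rewrite sum_count_mem //; apply/esym/eqP; rewrite -all_count; apply/allP.
rewrite big_cat (splits_size_undup split_s) addKn; congr (_ + _).
rewrite -sum1_count [RHS]big_mkcond [LHS]big_seq [RHS]big_seq; apply: eq_bigr => V.
by move/(splits_count_mem split_s)->; case: (V \in s).
Qed.

Lemma splits_placed s H L free V : splits s H L free ->
  count_mem V (L ++ twice H) <= count_mem V s.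
Proof.
case=> + heavy light _; rewrite catA cat_uniq => /and3P[+ _ _].
rewrite cat_uniq count_cat count_mem_twice => /and3P[uniq_H /hasPn notH uniq_L].
rewrite (count_uniq_mem _ uniq_L) (count_uniq_mem _ uniq_H) heavy.
have [L_V|_] := boolP (V \in L); last by case: ltnP.
by have := notH V L_V; rewrite heavy => /negPf->; rewrite count_mem_gt0 light.
Qed.

Lemma splits_skip s H L V free : splits s H L (V :: free) -> V \notin s ->
  splits s H L free.
Proof.
case=> uniq_HLF heavy light all_s notV; split=> // [|W s_W].
  by apply: subseq_uniq uniq_HLF; rewrite !cat_subseq ?subseq_cons.
have := all_s W s_W; rewrite !mem_cat inE.
by case: eqP s_W => [-> s_V|//]; rewrite s_V in notV.
Qed.

Lemma splits_place s H L V free : splits s H L (V :: free) -> V \in s ->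
  splits s H (V :: L) free.
Proof.
have perm_V : perm_eq (H ++ (V :: L) ++ free) (H ++ L ++ V :: free).
  by rewrite perm_cat2l -cat_rcons perm_cat2r perm_sym perm_rcons.
case=> uniq_HLF heavy light all_s s_V; split=> // [|W|W /all_s].
- by rewrite (perm_uniq perm_V).
- by rewrite inE => /orP[/eqP->|/light].
by rewrite (perm_mem perm_V).
Qed.

Section Stuck.

Variable s : seq nat.
Hypotheses (s_lt : all (gtn 30) s) (s_stuck : stuck s).

Lemma few_cubes_size H L free : splits s H L free ->
  few_cubes H (state_of (L ++ twice H)) (size L) free -> size s < 24.
Proof.
move=> split_s /allP few; set st := state_of _ in few.
have lt_trees V : V \in s -> count_mem V s < size (trees st V).
  by move=> /(allP s_lt); apply: stuck_trees => // W; apply: splits_placed split_s.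
have le_cap V : V \in s -> count_mem V s <= cap (size (undup s)).
  by move=> /(allP s_lt); apply: stuck_cap.
have: size (undup s) \in iota (size H + size L)
    (count (fun V => 1 < size (trees st V)) free).+1.
  rewrite mem_iota (splits_size_undup split_s) count_cat.
  have /eqP-> : count [in s] L == size L.
    by rewrite -all_count; apply/allP/(splits_light split_s).
  rewrite addnA leq_addr addnS ltnS leq_add2l /=; apply: sub_count => V s_V /=.
  by apply: leq_ltn_trans (lt_trees V s_V); rewrite count_mem_gt0.
move/few; case/orP=> [/eqP cap0|].
  have no_V V : V \notin s.
    apply/negP => s_V; have := le_cap V s_V; rewrite cap0 leqn0 => /eqP/count_memPn.
    by rewrite s_V.
  by case: (s) no_V => // V s' /(_ V); rewrite mem_head.
apply: leq_ltn_trans; rewrite (splits_size split_s) leq_add2r sumnE big_map.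
rewrite big_seq [leqRHS]big_seq; apply: leq_sum => V.
rewrite (splits_heavy split_s) => /ltnW; rewrite count_mem_gt0 => s_V.
rewrite leq_min le_cap // -ltnS prednK ?lt_trees //.
by apply: leq_ltn_trans (lt_trees V s_V).
Qed.

Lemma light_search_size H L free : splits s H L free ->
  light_search H (state_of (L ++ twice H)) (size L) free -> size s < 24.
Proof.
have placed L' free' : splits s H L' free' ->
    forall V, count_mem V (L' ++ twice H) <= count_mem V s.
  by move=> split_s V; apply: splits_placed split_s.
elim: free L => [|V free IHfree] L split_s /=;
    rewrite (negPf (stuck_not_dead s_lt s_stuck (placed _ _ split_s))).
  by case: ifP => // few _; apply: few_cubes_size few.
case: ifP => [few _|_ /andP[search_V search_free]]; first exact: few_cubes_size few.
have [s_V|notV] := boolP (V \in s); last exact: IHfree (splits_skip split_s notV) _.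
apply: IHfree (splits_place split_s s_V) _; move: search_V; rewrite ifT //.
have lt_V : V < 30 := allP s_lt V s_V.
apply: leq_ltn_trans (stuck_trees s_lt s_stuck (placed _ _ split_s) lt_V).
by rewrite count_mem_gt0.
Qed.

End Stuck.

(** * Permutations of the colors *)

Definition variety_act (c : seq nat) (V : nat) : nat :=
  variety_of (compose c (variety V)).

Lemma fits_act c q D V : coloring c -> coloring q -> V < 30 -> subseq D corners ->
  fits q D (variety_act c V) -> fits (compose (inverse c) q) D V.
Proof.
move=> c_col q_col lt_V /mem_subseq sub_D /hasP[d D_d].
have [V_col inv_col] := (variety_coloring lt_V, inverse_perm c_col).
have lt_d : all (gtn 6) d := cells_lt (mem_subseq (prefix_subseq _ _) (sub_D d D_d)).
have act_col := compose_perm c_col V_col.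
rewrite placeable_variety_of // => /(placeable_recolor inv_col act_col q_col lt_d).
rewrite composeA ?(is_perm_size c_col) ?(all_is_perm V_col) //.
by rewrite (inverse_compose c_col) (iota_compose V_col) => fit; apply/hasP; exists d.
Qed.

Lemma stuck_act c s : coloring c -> all (gtn 30) s -> stuck s ->
  stuck (map (variety_act c) s).
Proof.
move=> c_col s_lt s_stuck q q_col fill.
apply: (s_stuck _ (compose_perm (inverse_perm c_col) q_col)) => D sub_D.
apply: leq_trans (fill D sub_D) _; rewrite count_map.
by apply: sub_in_count => V /(allP s_lt) lt_V; apply: fits_act.
Qed.

(** * Heavy varieties *)

Definition heavy_state (H : seq nat) : state := state_of (twice H).

Definition color_actions : seq (seq nat * seq nat) :=
  Eval vm_compute in [seq (c, map (variety_act c) (iota 0 30)) | c <- colorings].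

Definition moves_into (level : seq (seq nat)) (H : seq nat)
    (action : seq nat * seq nat) : bool :=
  sort leq (compose action.2 H) \in level.

Definition witness (level : seq (seq nat)) (H : seq nat) : seq nat :=
  (nth ([::], [::]) color_actions (find (moves_into level H) color_actions)).1.

Definition next_level (level : seq (seq nat)) : seq (seq nat) :=
  let extensions H :=
    let st := heavy_state H in
    [seq V :: H | V <- iota 0 30 & (V \notin H) && ~~ dead (place V (place V st))] in
  foldl (fun reps H => if nilp (witness reps H) then sort leq H :: reps else reps)
        [::] (flatten (map extensions level)).

Definition levels : seq (seq (seq nat)) :=
  Eval vm_compute in traject next_level [:: [::]] 7.

(* For each representative [R] and each variety [V] that can be added to it, a
   permutation of the colors that moves [V :: R] to a representative. *)
Definition certificate : seq (seq (seq nat * seq (seq nat))) :=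
  Eval vm_compute in
  [seq [seq (R, let st := heavy_state R in
                [seq if (V \in R) || dead (place V (place V st)) then [::]
                     else witness (nth [::] levels (size R).+1) (V :: R)
                   | V <- iota 0 30]) | R <- level] | level <- levels].

(* The sets in [representatives j] represent, up to permutations of the colors, the sets
   of [j] varieties that do not by themselves exclude that a collection is stuck. *)
Definition representatives (j : nat) : seq (seq nat) := unzip1 (nth [::] certificate j).

Definition moved_by (j : nat) (H c : seq nat) : bool :=
  let images := map (variety_act c) H in
  coloring c && has (all [in images]) (representatives j).

Definition check_class (j : nat) (class : seq nat * seq (seq nat)) : bool :=
  let: (R, cs) := class in
  let st := heavy_state R in
  [&& uniq R,
      light_search R st 0 [seq V <- iota 0 30 | V \notin R]
    & all (fun V => [|| V \in R, dead (place V (place V st))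
                      | moved_by j.+1 (V :: R) (nth [::] cs V)]) (iota 0 30)].

Lemma certificate_checked :
  all (fun j => all (check_class j) (nth [::] certificate j)) (iota 0 7).
Proof. compute_true. Qed.

Lemma mem_representatives j R : R \in representatives j ->
  exists cs, check_class j (R, cs).
Proof.
case/mapP=> -[R' cs] class_in ->; exists cs.
case: (ltnP j 7) => [lt_j|le_j]; last by rewrite nth_default in class_in.
by have /all_iotaP/(_ j lt_j)/allP := certificate_checked; apply.
Qed.

Lemma variety_act_lt c V : coloring c -> V < 30 -> variety_act c V < 30.
Proof. by move=> c_col /variety_coloring V_col; apply/variety_of_lt/compose_perm. Qed.

Lemma count_mem_heavy s H V : uniq H -> {in H, forall W, 1 < count_mem W s} ->
  count_mem V (twice H) <= count_mem V s.
Proof.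
move=> uniq_H heavy; rewrite count_mem_twice count_uniq_mem //.
by case: (boolP (V \in H)) => // /heavy.
Qed.

Lemma light_search_heavy s R : all (gtn 30) s -> stuck s -> uniq R ->
  (forall V, (V \in R) = (1 < count_mem V s)) ->
  light_search R (heavy_state R) 0 [seq V <- iota 0 30 | V \notin R] -> size s < 24.
Proof.
move=> s_lt s_stuck uniq_R heavy_R.
suff split_s : splits s R [::] [seq V <- iota 0 30 | V \notin R].
  exact: (light_search_size s_lt s_stuck split_s).
split=> [|||V /(allP s_lt) lt_V]; [|exact: heavy_R|by []|].
  rewrite cat0s cat_uniq uniq_R filter_uniq ?iota_uniq // andbT.
  by apply/hasPn => V; rewrite mem_filter => /andP[].
by rewrite cat0s mem_cat mem_filter mem_iota [V < _]lt_V; case: (V \in R).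
Qed.

(* Downward induction on [j]: either [R] are all the varieties with at least two cubes,
   or another one can be added to them. *)
Lemma heavy_size j R s : R \in representatives j -> all (gtn 30) s -> stuck s ->
  {in R, forall V, 1 < count_mem V s} -> size s < 24.
Proof.
elim: {j}(7 - j) {-2}j (leqnn (7 - j)) R s => [|d IHd] j le_d R s.
  by rewrite /representatives nth_default // -subn_eq0 -leqn0.
move=> R_in s_lt s_stuck heavy_R; have [cs] := mem_representatives R_in.
case/and3P=> uniq_R search extend.
have [/hasP[V s_V /andP[notR heavy_V]]|/hasPn no_other] :=
    boolP (has (fun V => (V \notin R) && (1 < count_mem V s)) s); last first.
  apply: light_search_heavy search => // V; apply/idP/idP => [/heavy_R //|heavy_V].
  have s_V : V \in s by rewrite -count_mem_gt0 ltnW.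
  by have := no_other V s_V; rewrite heavy_V andbT negbK.
have heavy_VR : {in V :: R, forall W, 1 < count_mem W s}.
  by move=> W; rewrite inE => /orP[/eqP->|/heavy_R].
have uniq_VR : uniq (V :: R) by rewrite /= notR.
have alive : ~~ dead (heavy_state (V :: R)).
  by apply: (stuck_not_dead s_lt s_stuck) => W; apply: count_mem_heavy.
have := all_iotaP _ _ extend V (allP s_lt V s_V).
rewrite (negPf notR) (negPf alive) => /andP[c_col /hasP[R' R'_in /allP moved]].
set c := nth _ cs V in c_col moved; rewrite -(size_map (variety_act c)).
apply: IHd R'_in _ (stuck_act c_col s_lt s_stuck) _; first by rewrite subnS; lia.
  by apply/allP => _ /mapP[W /(allP s_lt) lt_W ->]; apply: variety_act_lt.
move=> W /moved /mapP[W' /heavy_VR heavy_W' ->].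
exact: leq_trans heavy_W' (leq_count_mem_map _ _ _).
Qed.

Theorem stuck_size s : all (gtn 30) s -> stuck s -> size s < 24.
Proof. by move=> s_lt s_stuck; apply: (@heavy_size 0 [::]). Qed.

(** * Edges *)

Definition color_pair (p d : seq nat) : seq nat := sort leq (compose p d).

Definition opposite_faces : seq (seq nat) := [:: [:: 0; 1]; [:: 2; 3]; [:: 4; 5]].

Definition opposites (p : seq nat) : seq (seq nat) := map (color_pair p) opposite_faces.

Definition opp (V : nat) : seq (seq nat) := opposites (variety V).

Lemma color_pair_swap p i j : color_pair p [:: i; j] = color_pair p [:: j; i].
Proof.
apply/perm_sortP; [exact: leq_total | exact: leq_trans | exact: anti_leq |].
by rewrite /= (perm_catC [:: _] [:: _]).
Qed.

Lemma color_pair_opposites p i j : i < 6 -> j < 6 -> i != j -> i./2 = j./2 ->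
  color_pair p [:: i; j] \in opposites p.
Proof.
move=> lt_i lt_j neq_ij eq_half.
have: (i != j) && (i./2 == j./2) ==>
    ([:: i; j] \in opposite_faces) || ([:: j; i] \in opposite_faces).
  by move: i j lt_i lt_j {neq_ij eq_half}; apply/all_iota2P.
rewrite neq_ij eq_half eqxx => /orP[] opp_ij; first exact: map_f.
by rewrite color_pair_swap; apply: map_f.
Qed.

Lemma edge_rotation e i j : e \in edges -> i < 6 -> j < 6 -> i./2 != j./2 ->
  exists2 u, u \in rotations & compose u e = [:: i; j].
Proof.
have: all (fun e => all (fun i => all (fun j => (i./2 == j./2)
    || has (fun u => compose u e == [:: i; j]) rotations) (iota 0 6)) (iota 0 6)) edges.
  by compute_true.
move=> /allP/[apply]/all_iota2P checked lt_i lt_j /negPf neq_ij.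
have := checked i j lt_i lt_j; rewrite neq_ij => /hasP[u u_rot /eqP].
by exists u.
Qed.

Lemma edgeP e : e \in edges -> exists f g, [/\ e = [:: f; g], f < 6, g < 6 & f != g].
Proof.
have: all (fun e => if e is [:: f; g] then [&& f < 6, g < 6 & f != g] else false) edges.
  by [].
by move/allP/[apply]; case: e => [|f [|g []]] // /and3P[]; exists f, g.
Qed.

Lemma placeable_edge p q e : coloring p -> coloring q -> e \in edges ->
  color_pair q e \notin opposites p -> placeable p q e.
Proof.
move=> p_col q_col e_edge; have [f [g [def_e lt_f lt_g neq_fg]]] := edgeP e_edge.
have find_in_p h : h < 6 -> exists2 i, i < 6 & nth 0 p i = nth 0 q h.
  move=> lt_h; have p_h : nth 0 q h \in p.
    by rewrite (mem_is_perm p_col) (is_perm_lt q_col).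
  exists (index (nth 0 q h) p); last exact: nth_index.
  by rewrite -(is_perm_size p_col) index_mem.
have [[i lt_i p_i] [j lt_j p_j]] := (find_in_p f lt_f, find_in_p g lt_g).
have ->: color_pair q e = color_pair p [:: i; j].
  by rewrite /color_pair /compose def_e /= p_i p_j.
have neq_ij : i != j.
  apply: contraNneq neq_fg => eq_ij; move: p_j; rewrite -eq_ij p_i => /eqP.
  by rewrite nth_uniq ?(is_perm_size q_col) ?(is_perm_uniq q_col).
have [eq_half|neq_half _] := eqVneq i./2 j./2.
  by rewrite color_pair_opposites.
have [u u_rot def_u] := edge_rotation e_edge lt_i lt_j neq_half.
apply/hasP; exists u => //; move: def_u; rewrite def_e => -[u_f u_g].
by rewrite /= u_f u_g p_i p_j !eqxx.
Qed.

Lemma color_pair_edges_uniq q E : coloring q -> subseq E edges ->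
  uniq (map (color_pair q) E).
Proof.
move=> q_col /(map_subseq (color_pair q))/subseq_uniq; apply; move: q q_col.
by apply: all_coloringsP; compute_true.
Qed.

Lemma misfit_opp q E V : V < 30 -> coloring q -> subseq E edges ->
  ~~ fits q E V -> all [in opp V] (map (color_pair q) E).
Proof.
move=> lt_V q_col /mem_subseq sub_E misfit; apply/allP => _ /mapP[e E_e ->].
apply: contraNT misfit => not_opp; apply/hasP; exists e => //.
exact: placeable_edge (variety_coloring lt_V) q_col (sub_E e E_e) not_opp.
Qed.

Definition with_opposites (s : seq nat) (X : seq (seq nat)) : nat :=
  count (fun V => all [in opp V] X) s.

Lemma with_opposites_gt0 s X : 0 < with_opposites s X ->
  exists2 V, V \in s & all [in opp V] X.
Proof. by rewrite -has_count => /hasP. Qed.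

(** * Mirror images *)

Definition mirror (V : nat) : nat :=
  variety_of (compose (variety V) [:: 1; 0; 2; 3; 4; 5]).

Lemma mirror_lt V : V < 30 -> mirror V < 30.
Proof. by move: V; apply/all_iotaP; compute_true. Qed.

Lemma mirror_neq V : V < 30 -> V != mirror V.
Proof. by move: V; apply/all_iotaP; compute_true. Qed.

Lemma mirrorK V : V < 30 -> mirror (mirror V) = V.
Proof. by move=> lt_V; apply/eqP; move: V lt_V; apply/all_iotaP; compute_true. Qed.

Lemma opp_mirror V : V < 30 -> opp (mirror V) =i opp V.
Proof.
move=> lt_V; have: perm_eq (opp (mirror V)) (opp V).
  by move: V lt_V; apply/all_iotaP; compute_true.
exact: perm_mem.
Qed.

Lemma shared_or_mirror T V : T < 30 -> V < 30 ->
  (shared V T != [::]) || (shared V (mirror T) != [::]).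
Proof. by move: T V; apply/all_iota2P; compute_true. Qed.

Lemma eq_opposites_mirror T V : T < 30 -> V < 30 ->
  1 < count [in opp T] (opp V) -> V \in [:: T; mirror T].
Proof.
move=> lt_T lt_V; apply/implyP; move: T V lt_T lt_V.
by apply/all_iota2P; compute_true.
Qed.

Lemma color_pair_opp T e : T < 30 -> e \in edges ->
  color_pair (variety T) e \notin opp T.
Proof.
have: all (fun T => all (fun e => color_pair (variety T) e \notin opp T) edges)
  (iota 0 30) by compute_true.
by move=> /all_iotaP checked /checked/allP; apply.
Qed.

Lemma fits_mirror T e V : T < 30 -> e \in edges -> V \in [:: T; mirror T] ->
  placeable (variety V) (variety T) e.
Proof.
move=> lt_T e_edge; rewrite !inE => V_T; have e_opp := color_pair_opp lt_T e_edge.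
have lt_V : V < 30 by case/orP: V_T => /eqP->; rewrite ?mirror_lt.
apply: placeable_edge (variety_coloring lt_V) (variety_coloring lt_T) e_edge _.
by case/orP: V_T => /eqP-> //; rewrite -/(opp _) opp_mirror.
Qed.

Lemma fits_self T D : T < 30 -> subseq D corners -> D != [::] -> fits (variety T) D T.
Proof.
move=> lt_T sub_D; rewrite -size_eq0 -lt0n fits_shared // shared_self // => D_gt0.
by rewrite has_count -size_corners.
Qed.

Definition mirror_count (s : seq nat) (T : nat) : nat := count [in [:: T; mirror T]] s.

Definition sharing_count (s : seq nat) (T : nat) : nat :=
  count (fun V => shared V T != [::]) s.

Definition frequent (s : seq nat) (T : nat) : bool :=
  (6 < count_mem T s) && ((7 < count_mem T s) || (7 < sharing_count s T)).

(** * Obstructions on edges *)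

Section Edges.

Variable s : seq nat.
Hypotheses (s_lt : all (gtn 30) s) (size_s : size s = 24).

Lemma count_misfit q E : coloring q -> subseq E edges ->
  24 - with_opposites s (map (color_pair q) E) <= count (fits q E) s.
Proof.
move=> q_col sub_E; rewrite leq_subLR -size_s -(count_predC (fits q E)) addnC leq_add2r.
apply: sub_in_count => V /(allP s_lt) lt_V; exact: misfit_opp.
Qed.

Lemma fits_four_edges q E : coloring q -> subseq E edges -> 3 < size E ->
  count (fits q E) s = 24.
Proof.
move=> q_col sub_E gt3; rewrite -size_s; apply/eqP; rewrite -all_count.
apply/allP => V s_V; have lt_V := allP s_lt V s_V; apply: contraTT gt3 => misfit.
rewrite -leqNgt -(size_map (color_pair q)); apply: (uniq_leq_size (s2 := opp V)).
  exact: color_pair_edges_uniq.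
exact/allP/misfit_opp.
Qed.

Lemma fillable_frame q : coloring q -> fillable corners s q ->
  (forall D e, subseq D corners -> e \in edges ->
     size D < count (fits q (D ++ [:: e])) s) ->
  (forall e f, e != f -> subseq [:: e; f] edges -> 11 <= count (fits q [:: e; f]) s) ->
  fillable (corners ++ edges) s q.
Proof.
move=> q_col fill_corners fill_edge fill_edges _ /subseq_cat_split[D [E [-> sub_D sub_E]]].
rewrite size_cat; have le_D := size_subseq sub_D.
have [gt3|le3] := ltnP 3 (size E).
  have := leq_count_fits q s (mem_subseq (suffix_subseq D E)).
  rewrite (fits_four_edges q_col sub_E gt3); apply: leq_trans.
  by apply: leq_trans (leq_add le_D (size_subseq sub_E)) _.
case: E sub_E le3 => [|e [|f E]] sub_E le3.
- by rewrite cats0 addn0; apply: fill_corners.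
- by rewrite addn1; apply: fill_edge => //; rewrite -sub1seq.
have sub_ef : subseq [:: e; f] (e :: f :: E) by rewrite (prefix_subseq [:: e; f]).
apply: leq_trans (leq_add le_D le3) _.
apply: leq_trans (fill_edges e f _ (subseq_trans sub_ef sub_E)) _.
  by have /subseq_uniq/(_ isT) := sub_E; rewrite /= inE negb_or => /andP[/andP[]].
apply: leq_count_fits => d /(mem_subseq sub_ef); rewrite mem_cat => ->.
exact: orbT.
Qed.

Lemma count_fits_two_edges q e f : coloring q -> subseq [:: e; f] edges -> e != f ->
  (forall x y, x != y -> with_opposites s [:: x; y] <= 13) ->
  11 <= count (fits q [:: e; f]) s.
Proof.
move=> q_col sub_ef neq_ef le13; apply: leq_trans (count_misfit q_col sub_ef).
have := color_pair_edges_uniq q_col sub_ef; rewrite /= inE andbT => /le13.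
by move=> /(leq_sub2l 24).
Qed.

Lemma fillable_spread q : coloring q -> fillable corners s q ->
  (forall x, with_opposites s [:: x] <= 15) ->
  (forall x y, x != y -> with_opposites s [:: x; y] <= 13) ->
  fillable (corners ++ edges) s q.
Proof.
move=> q_col fill_corners le15 le13; apply: fillable_frame => // [D e sub_D e_edge|].
  have sub_e : subseq [:: e] edges by rewrite sub1seq.
  apply: leq_trans (leq_count_fits q s (D := [:: e]) _).
    apply: leq_ltn_trans (size_subseq sub_D) _.
    apply: leq_trans (count_misfit q_col sub_e).
    by apply: leq_trans (leq_sub2l 24 (le15 _)).
  by move=> d; rewrite mem_cat => ->; rewrite orbT.
by move=> e f neq_ef sub_ef; apply: count_fits_two_edges.
Qed.

Lemma with_opposites_mirror x y :
  (forall T, T < 30 -> mirror_count s T <= 13) ->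
  x != y -> with_opposites s [:: x; y] <= 13.
Proof.
move=> le13 neq_xy.
have [-> //|/with_opposites_gt0[T s_T opp_T]] := posnP (with_opposites s [:: x; y]).
apply: leq_trans (le13 T (allP s_lt T s_T)); apply: sub_in_count => V s_V opp_V.
apply: eq_opposites_mirror (allP s_lt T s_T) (allP s_lt V s_V) _.
rewrite -size_filter; apply: (@uniq_leq_size _ [:: x; y]).
  by rewrite /= inE neq_xy.
by move=> z xy_z; rewrite mem_filter (allP opp_T z xy_z) (allP opp_V z xy_z).
Qed.

Lemma fillable_corners_frequent T : T < 30 -> frequent s T ->
  fillable corners s (variety T).
Proof.
move=> lt_T /andP[gt6 gt7] D sub_D; have [-> //|D_neq0] := eqVneq D [::].
have fit_T : count_mem T s <= count (fits (variety T) D) s.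
  by apply: sub_count => V /eqP->; apply: fits_self.
have le_D : size D <= 8 := size_subseq sub_D.
have [lt_D|ge_D] := ltnP (size D) 8; first by apply: leq_trans fit_T; lia.
have def_D : D = corners by apply/eqP; rewrite -(geq_leqif (size_subseq_leqif sub_D)).
case/orP: gt7 => gt7; first by apply: leq_trans fit_T; apply: leq_trans gt7.
apply: leq_trans le_D (leq_trans gt7 _); apply: sub_in_count => V /(allP s_lt) lt_V.
rewrite fits_shared // def_D; case: (shared V T) (shared_lt V T) => //= k ks.
by case/andP=> lt_k _ _; rewrite [corner k \in _]mem_nth.
Qed.

Lemma fillable_mirror_pair T : T < 30 -> 13 < mirror_count s T -> frequent s T ->
  fillable (corners ++ edges) s (variety T).
Proof.
move=> lt_T gt13 freq_T; have T_col := variety_coloring lt_T.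
have fit_edge D e : e \in edges -> e \in D -> 13 < count (fits (variety T) D) s.
  move=> e_edge D_e; apply: leq_trans gt13 _; apply: sub_count => V V_T.
  by apply/hasP; exists e => //; apply: fits_mirror.
apply: fillable_frame => // [|D e sub_D e_edge|e f _ sub_ef].
- exact: fillable_corners_frequent.
- apply: leq_ltn_trans (size_subseq sub_D) _.
  apply: ltn_trans (fit_edge _ e e_edge _) => //.
  by rewrite mem_cat mem_head orbT.
apply: (@leq_trans 14) => //; apply: (fit_edge _ e); last exact: mem_head.
exact: (mem_subseq sub_ef) (mem_head _ _).
Qed.

Lemma fillable_mirror T : T < 30 -> 13 < mirror_count s T ->
  exists2 q, coloring q & fillable (corners ++ edges) s q.
Proof.
move=> lt_T gt13; have lt_T' := mirror_lt lt_T.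
have count_pair : mirror_count s T = count_mem T s + count_mem (mirror T) s.
  by rewrite /mirror_count -sum_count_mem ?big_cons ?big_nil ?addn0 //= inE andbT mirror_neq.
have cover : 24 <= sharing_count s T
                   + sharing_count s (mirror T).
  rewrite -size_s -count_predUI; apply: leq_trans (leq_addr _ _).
  rewrite -[leqLHS]count_predT; apply: sub_in_count => V /(allP s_lt) lt_V _.
  exact: shared_or_mirror.
have swap : mirror_count s (mirror T) = mirror_count s T.
  by apply: eq_count => V; rewrite mirrorK // !inE orbC.
have /orP[freq_T|freq_T'] : frequent s T || frequent s (mirror T).
- by rewrite /frequent; lia.
- by exists (variety T); [apply: variety_coloring | apply: fillable_mirror_pair].
exists (variety (mirror T)); first exact: variety_coloring.
by apply: (fillable_mirror_pair lt_T' _ freq_T'); rewrite swap.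
Qed.

End Edges.

(** * Sextets *)

(* The six varieties with the opposite colors [x] form three mirror pairs; the four
   that are not in the pair of [T] share disjoint pairs of corners with [T]. *)
Record sextet (x : seq nat) (T T' U U' W W' : nat) : Prop := Sextet {
  sextet_perm : perm_eq [seq V <- iota 0 30 | x \in opp V] [:: T; T'; U; U'; W; W'];
  sextet_corners :
    perm_eq (shared U T ++ shared U' T ++ shared W T ++ shared W' T) (iota 0 8);
  sextet_size : all (fun V => size (shared V T) == 2) [:: U; U'; W; W'];
  sextet_mirror : [/\ opp T' =i opp T, opp U' =i opp U & opp W' =i opp W];
  sextet_meet : forall y, y \in opp U -> y \in opp W -> y = x }.

Lemma sextet_exists T x : T < 30 -> x \in opp T ->
  exists T' U U' W W', sextet x T T' U U' W W'.
Proof.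
have: all (fun T => all (fun x =>
    let same := [seq V <- iota 0 30 | x \in opp V] in
    has (fun U => has (fun W =>
      [&& perm_eq same [:: T; mirror T; U; mirror U; W; mirror W],
          perm_eq (shared U T ++ shared (mirror U) T
                   ++ shared W T ++ shared (mirror W) T) (iota 0 8),
          all (fun V => size (shared V T) == 2) [:: U; mirror U; W; mirror W]
        & all (fun y => (y \in opp W) ==> (y == x)) (opp U)]) same) same)
  (opp T)) (iota 0 30) by compute_true.
move=> /all_iotaP checked lt_T x_T; have /hasP[U] := allP (checked T lt_T) x x_T.
rewrite mem_filter mem_iota => /andP[_ lt_U] /hasP[W].
rewrite mem_filter mem_iota => /andP[_ lt_W].
case/and4P=> perm_S corners_S size_S /allP meet_S.
exists (mirror T), U, (mirror U), W, (mirror W); split=> // [|y /meet_S/implyP + y_W].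
  by split; apply: opp_mirror.
by move=> /(_ y_W)/eqP.
Qed.

Section Sextet.

Variables (x : seq nat) (T T' U U' W W' : nat).
Hypotheses (lt_T : T < 30) (sextet_T : sextet x T T' U U' W W').

Let S := [:: T; T'; U; U'; W; W'].

Lemma mem_sextet V : (V \in S) = (V < 30) && (x \in opp V).
Proof. by rewrite -(perm_mem (sextet_perm sextet_T)) mem_filter mem_iota andbC. Qed.

Lemma sextet_uniq : uniq S.
Proof. by rewrite -(perm_uniq (sextet_perm sextet_T)) filter_uniq ?iota_uniq. Qed.

Lemma sextet_lt V : V \in S -> V < 30.
Proof. by rewrite mem_sextet => /andP[]. Qed.

Lemma size_corners_sextet D : subseq D corners ->
  size D <= 2 * fits (variety T) D U + (2 * fits (variety T) D U'
            + (2 * fits (variety T) D W + 2 * fits (variety T) D W')).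
Proof.
case: sextet_T => _ /seq.permP all_corners /allP size2 _ _ sub_D.
have half V : V \in [:: U; U'; W; W'] ->
    count (fun k => corner k \in D) (shared V T) <= 2 * fits (variety T) D V.
  move=> V_in; rewrite -(eqP (size2 V V_in)) fits_shared ?leq_count_has //.
  by apply: sextet_lt; apply: (mem_subseq _ V_in); apply: (suffix_subseq [:: _; _]).
rewrite (size_corners sub_D) -all_corners !count_cat.
by apply: leq_add _ (leq_add _ (leq_add _ _)); apply: half; rewrite !inE eqxx ?orbT.
Qed.

End Sextet.

(* [c] corners of the most frequent variety [T] of a sextet and possibly an edge are to
   be filled: [t], [t'], [u], [u'], [w], [w'] count the cubes in the sextet, [hu], ...
   tell if these share one of the corners, and [eu], [ew] if they fit on the edge. *)
Lemma sextet_corner_bound (t t' u u' w w' c : nat) (ht' hu hu' hw hw' : bool) :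
  t' <= t -> u <= t -> u' <= t -> w <= t -> w' <= t ->
  15 < t + t' + u + u' + w + w' ->
  c <= 2 * hu + (2 * hu' + (2 * hw + 2 * hw')) ->
  c <= t + ht' * t' + hu * u + hu' * u' + hw * w + hw' * w'.
Proof. by case: ht'; case: hu; case: hu'; case: hw; case: hw'; lia. Qed.

Lemma sextet_edge_bound (t t' u u' w w' c : nat) (hu hu' hw hw' eu ew : bool) :
  t' <= t -> u <= t -> u' <= t -> w <= t -> w' <= t ->
  15 < t + t' + u + u' + w + w' -> eu || ew ->
  c <= 2 * hu + (2 * hu' + (2 * hw + 2 * hw')) ->
  c < t + t' + (hu || eu) * u + (hu' || eu) * u' + (hw || ew) * w + (hw' || ew) * w'.
Proof.
by case: hu; case: hu'; case: hw; case: hw'; case: eu; case: ew => //; lia.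
Qed.

Lemma most_frequent_opp s x : all (gtn 30) s -> 0 < with_opposites s [:: x] ->
  exists2 T, (T < 30) && (x \in opp T) &
    forall V, V < 30 -> x \in opp V -> count_mem V s <= count_mem T s.
Proof.
move=> s_lt /with_opposites_gt0[T0 s_T0]; rewrite /= andbT => x_T0.
pose count_of (T : 'I_30) := count_mem (val T) s.
pose T1 : 'I_30 := Ordinal (allP s_lt T0 s_T0).
case: (@arg_maxnP _ T1 (fun T : 'I_30 => x \in opp T) count_of) => // T x_T max_T.
exists (val T); first by rewrite ltn_ord.
by move=> V lt_V x_V; apply: (max_T (Ordinal lt_V)).
Qed.

Section MostFrequent.

Variables (s x : seq nat) (T T' U U' W W' : nat).
Hypotheses (s_lt : all (gtn 30) s) (lt_T : T < 30).
Hypothesis sextet_T : sextet x T T' U U' W W'.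
Hypothesis max_T : forall V, V < 30 -> x \in opp V -> count_mem V s <= count_mem T s.
Hypothesis gt15 : 15 < with_opposites s [:: x].

Local Notation m V := (count_mem V s).

Lemma sextet_le_max V : V \in [:: T; T'; U; U'; W; W'] -> m V <= m T.
Proof. by rewrite (mem_sextet sextet_T) => /andP[]; apply: max_T. Qed.

Lemma sextet_sum : 15 < m T + m T' + m U + m U' + m W + m W'.
Proof.
have: with_opposites s [:: x] <= \sum_(V <- [:: T; T'; U; U'; W; W']) m V.
  rewrite (sum_count_mem _ (sextet_uniq sextet_T)).
  apply: sub_in_count => V /(allP s_lt) lt_V; rewrite /= andbT => x_V.
  by rewrite (mem_sextet sextet_T) x_V andbT.
by rewrite !big_cons big_nil addn0 !addnA; apply: leq_trans.
Qed.

Lemma leq_count_sextet (P : pred nat) :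
  P T * m T + P T' * m T' + P U * m U + P U' * m U' + P W * m W + P W' * m W'
    <= count P s.
Proof.
have := leq_sum_count_mem P s (sextet_uniq sextet_T).
by rewrite !big_cons big_nil addn0 !addnA.
Qed.

Lemma fillable_corners_sextet : fillable corners s (variety T).
Proof.
move=> D sub_D; have [-> //|D_neq0] := eqVneq D [::].
apply: leq_trans (leq_count_sextet (fits (variety T) D)).
rewrite fits_self // mul1n; apply: sextet_corner_bound sextet_sum _;
  try by apply: sextet_le_max; rewrite !inE eqxx ?orbT.
exact: (size_corners_sextet lt_T sextet_T sub_D).
Qed.

Lemma fillable_edge_sextet D e : subseq D corners -> e \in edges ->
  size D < count (fits (variety T) (D ++ [:: e])) s.
Proof.
move=> sub_D e_edge; pose y := color_pair (variety T) e.
have y_T : y \notin opp T by apply: color_pair_opp.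
pose fits_or V := fits (variety T) D V || (y \notin opp V).
apply: leq_trans (_ : count fits_or s <= _); last first.
  apply: sub_in_count => V /(allP s_lt) lt_V; rewrite /fits_or /fits has_cat has_seq1.
  case/orP=> [-> //|y_V]; apply/orP; right.
  exact: placeable_edge (variety_coloring lt_V) (variety_coloring lt_T) e_edge y_V.
apply: leq_trans (leq_count_sextet fits_or); rewrite /fits_or.
have [_ _ _ [opp_T' opp_U' opp_W'] meet] := sextet_T.
rewrite opp_T' opp_U' opp_W' y_T !orbT !mul1n; apply: sextet_edge_bound sextet_sum _ _;
  try by apply: sextet_le_max; rewrite !inE eqxx ?orbT.
  rewrite -negb_and; apply: contra y_T => /andP[y_U y_W]; rewrite (meet y y_U y_W).
  have: T \in [:: T; T'; U; U'; W; W'] := mem_head _ _.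
  by rewrite (mem_sextet sextet_T) => /andP[].
exact: (size_corners_sextet lt_T sextet_T sub_D).
Qed.

End MostFrequent.

Lemma fillable_opposites s x : all (gtn 30) s -> size s = 24 ->
  15 < with_opposites s [:: x] ->
  (forall y z, y != z -> with_opposites s [:: y; z] <= 13) ->
  exists2 q, coloring q & fillable (corners ++ edges) s q.
Proof.
move=> s_lt size_s gt15 le13.
have [T /andP[lt_T x_T] max_T] := most_frequent_opp s_lt (ltn_trans (ltn0Sn _) gt15).
have [T' [U [U' [W [W' sextet_T]]]]] := sextet_exists lt_T x_T.
have T_col := variety_coloring lt_T; exists (variety T) => //.
apply: (fillable_frame s_lt size_s T_col) => [|D e sub_D e_edge|e f neq_ef sub_ef].
- exact: fillable_corners_sextet s_lt lt_T sextet_T max_T gt15.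
- exact: fillable_edge_sextet s_lt lt_T sextet_T max_T gt15 _ _ sub_D e_edge.
exact: count_fits_two_edges sub_ef neq_ef le13.
Qed.

Theorem exists_fillable s : all (gtn 30) s -> size s = 24 ->
  exists2 q, coloring q & fillable (corners ++ edges) s q.
Proof.
move=> s_lt size_s.
have [/hasP[T]|/hasPn few_mirror] :=
  boolP (has (fun T => 13 < mirror_count s T) (iota 0 30)).
  by rewrite mem_iota => lt_T; apply: fillable_mirror.
have le13 y z : y != z -> with_opposites s [:: y; z] <= 13.
  apply: with_opposites_mirror => // T lt_T; rewrite leqNgt.
  by apply: few_mirror; rewrite mem_iota.
have [/hasP[V _ /hasP[x _ gt15]]|/hasPn few_opp] :=
  boolP (has (fun V => has (fun x => 15 < with_opposites s [:: x]) (opp V)) s).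
  exact: fillable_opposites gt15 le13.
have le15 x : with_opposites s [:: x] <= 15.
  have [-> //|/with_opposites_gt0[V s_V]] := posnP (with_opposites s [:: x]).
  by rewrite /= andbT leqNgt; apply: (hasPn (few_opp V s_V)).
have [s_stuck|[q q_col fill_q]] := stuck_or_fillable s.
  by have := stuck_size s_lt s_stuck; rewrite size_s.
by exists q => //; apply: fillable_spread.
Qed.

(** * Rotations *)

Definition axis0 : 'I_3 := @Ordinal 3 0 isT.
Definition axis1 : 'I_3 := @Ordinal 3 1 isT.
Definition axis2 : 'I_3 := @Ordinal 3 2 isT.

Lemma axisP (a : 'I_3) : [\/ a = axis0, a = axis1 | a = axis2].
Proof.
case: a => [[|[|[|//]]] lt_a]; [constructor 1 | constructor 2 | constructor 3];
  exact: val_inj.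
Qed.

Definition axis_perms : seq 'S_3 :=
  [:: 1; tperm axis1 axis2; tperm axis0 axis1; tperm axis0 axis2;
      tperm axis0 axis1 * tperm axis0 axis2; tperm axis0 axis2 * tperm axis0 axis1]%g.

Definition values_of (s : 'S_3) : seq nat :=
  [:: val (s axis0); val (s axis1); val (s axis2)].

Lemma axis_perms_values :
  [seq (values_of s, odd_perm s) | s <- axis_perms] = axis_values.
Proof.
by rewrite /= /values_of !odd_permM !odd_tperm odd_perm1 !permM !perm1 !permE /=
  ?permE.
Qed.

Lemma mem_axis_perms (s : 'S_3) : s \in axis_perms.
Proof.
have uniq_S3 : uniq axis_perms.
  apply: (map_uniq (f := fun s => (values_of s, odd_perm s))).
  by rewrite axis_perms_values.
have sub_S3 : {subset axis_perms <= enum 'S_3} by move=> t; rewrite mem_enum.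
have [|_ ->] := uniq_min_size uniq_S3 sub_S3; last by rewrite mem_enum.
by rewrite -cardE card_Sn.
Qed.

Definition face_index (f : face) : nat := 2 * f.1 + f.2.

Definition faces : seq face :=
  [:: (axis0, false); (axis0, true); (axis1, false); (axis1, true);
      (axis2, false); (axis2, true)].

Lemma mem_faces f : f \in faces.
Proof. by case: f => a b; case: (axisP a) => ->; case: b. Qed.

Lemma face_index_lt f : face_index f < 6.
Proof. by case: f => a b; case: (axisP a) => ->; case: b. Qed.

Lemma nth_faces f : nth (axis0, false) faces (face_index f) = f.
Proof. by case: f => a b; case: (axisP a) => ->; case: b. Qed.

Lemma face_index_nth g : g < 6 -> face_index (nth (axis0, false) faces g) = g.
Proof. by case: g => [|[|[|[|[|[|]]]]]]. Qed.

Lemma det_isometry (r : 'S_3 * {ffun 'I_3 -> bool}) :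
  (\det (isometry_mx r) == 1)%R
    = (odd_perm r.1 == odd (r.2 axis0 + r.2 axis1 + r.2 axis2)).
Proof.
rewrite /isometry_mx det_mulmx det_diag det_perm !big_ord_recl big_ord0 !mxE
  GRing.mulr1.
have ->: ord0 = axis0 by apply: val_inj.
have ->: lift axis0 (ord0 : 'I_2) = axis1 by apply: val_inj.
have ->: lift axis0 (lift ord0 (ord0 : 'I_1)) = axis2 by apply: val_inj.
by case: (r.2 axis0); case: (r.2 axis1); case: (r.2 axis2); case: (odd_perm r.1).
Qed.

Definition face_table (r : rotation) : seq nat :=
  [seq face_index (rotate r f) | f <- faces].

Lemma nth_face_table r f :
  nth 0 (face_table r) (face_index f) = face_index (rotate r f).
Proof. by rewrite (nth_map (axis0, false)) ?nth_faces ?face_index_lt. Qed.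

Lemma face_tableE r : face_table r =
  face_values (values_of (val r).1)
              [:: (val r).2 axis0; (val r).2 axis1; (val r).2 axis2].
Proof.
rewrite /face_table /rotate /face_index /face_values /=.
by case: ((val r).2 axis0); case: ((val r).2 axis1); case: ((val r).2 axis2).
Qed.

Lemma face_table_rotation r : face_table r \in rotations.
Proof.
have := valP r; rewrite det_isometry => /eqP parity; rewrite face_tableE rotationsE.
apply/allpairsPdep; exists (values_of (val r).1, odd_perm (val r).1).
exists [:: (val r).2 axis0; (val r).2 axis1; (val r).2 axis2]; split=> //.
  rewrite -axis_perms_values; apply: (map_f (fun s => (values_of s, odd_perm s))).
  exact: mem_axis_perms.
rewrite mem_filter /= addn0 addnA parity eqxx.
by case: ((val r).2 axis0); case: ((val r).2 axis1); case: ((val r).2 axis2).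
Qed.

Lemma rotation_of_table u : u \in rotations -> exists r, face_table r = u.
Proof.
rewrite rotationsE => /allpairsPdep[[vs b] [e [sb_in e_in ->]]] /=.
have [s [vsE bE]] : exists s, values_of s = vs /\ odd_perm s = b.
  by move: sb_in; rewrite -axis_perms_values => /mapP[s _ [-> ->]]; exists s.
have [e0 [e1 [e2 [def_e parity]]]] :
  exists e0 e1 e2, e = [:: e0; e1; e2] /\ odd (e0 + e1 + e2) = b.
  move: e_in; rewrite mem_filter => /andP[/eqP /= parity].
  case/allpairsP=> -[e0 [e1 e2]] [_ _ def_e]; exists e0, e1, e2; split=> //.
  by rewrite -parity def_e /= addn0 addnA.
pose rev := [ffun a : 'I_3 => nth false e a].
have det1 : (\det (isometry_mx (s, rev)) == 1)%R.
  by rewrite det_isometry /= !ffunE def_e /= parity bE.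
by exists (Sub (s, rev) det1); rewrite face_tableE SubK /= !ffunE vsE def_e.
Qed.

(** * Colored cubes and colorings *)

Definition coloring_of (p : colored_cube) : seq nat :=
  [seq val (paint p f) | f <- faces].

Lemma nth_coloring_of p f : nth 0 (coloring_of p) (face_index f) = paint p f.
Proof. by rewrite (nth_map (axis0, false)) ?nth_faces ?face_index_lt. Qed.

Lemma coloring_ofP p : coloring (coloring_of p).
Proof.
have sub : {subset iota 0 6 <= coloring_of p}.
  move=> c; rewrite mem_iota add0n => /= lt_c.
  have /forallP/(_ (Ordinal lt_c))/existsP[f /eqP p_f] := valP p.
  by apply/mapP; exists f; rewrite ?mem_faces // /paint p_f.
rewrite /coloring /is_perm perm_sym; apply: uniq_perm (iota_uniq 0 6) _ _.
  by apply: leq_size_uniq sub _; rewrite ?iota_uniq ?size_map.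
by have [] := uniq_min_size (iota_uniq 0 6) sub _; rewrite ?size_map.
Qed.

Lemma cube_of_coloring q : coloring q -> exists p, coloring_of p = q.
Proof.
move=> q_col; pose paint_q : {ffun face -> color} :=
  [ffun f => inord (nth 0 q (face_index f))].
have paint_qE f : paint_q f = nth 0 q (face_index f) :> nat.
  by rewrite ffunE /= inordK //; apply: is_perm_lt q_col _ (face_index_lt f).
have surj : [forall c, [exists f, paint_q f == c]].
  apply/forallP => c; have q_c : val c \in q.
    by rewrite (mem_is_perm q_col) [val c < 6]ltn_ord.
  have lt_i : index (val c) q < 6 by move: q_c; rewrite -index_mem (is_perm_size q_col).
  apply/existsP; exists (nth (axis0, false) faces (index (val c) q)).
  by apply/eqP/val_inj; rewrite [LHS]paint_qE face_index_nth // nth_index.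
exists (Sub paint_q surj); apply: (@eq_from_nth _ 0) => [|g].
  by rewrite size_map (is_perm_size q_col).
rewrite size_map => lt_g; rewrite -(face_index_nth lt_g) nth_coloring_of.
by rewrite /paint SubK paint_qE.
Qed.

Definition matches (p q : colored_cube) (n : nat) (x : position n) (r : rotation)
  : bool :=
  [forall g, on_face x (rotate r g) ==> (paint p g == paint q (rotate r g))].

Lemma placeableP p q n (x : position n) d :
  (forall f, on_face x f = (face_index f \in d)) -> all (gtn 6) d ->
  reflect (exists r, matches p q x r) (placeable (coloring_of p) (coloring_of q) d).
Proof.
move=> on_d /allP lt_d; apply: (iffP hasP) => [[u u_rot /allP u_ok]|[r /forallP r_ok]].
  have [r def_r] := rotation_of_table (rotation_inverse u_rot).
  have u_col := rotation_coloring u_rot.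
  exists r; apply/forallP => f; apply/implyP; rewrite on_d => /u_ok.
  rewrite -nth_face_table def_r -[nth 0 u _]nth_compose; last first.
    by rewrite (is_perm_size (inverse_perm u_col)) face_index_lt.
  rewrite (compose_inverse u_col) nth_iota ?face_index_lt // nth_coloring_of.
  by rewrite -def_r nth_face_table nth_coloring_of.
have r_rot := face_table_rotation r; have r_col := rotation_coloring r_rot.
exists (inverse (face_table r)); first exact: rotation_inverse.
apply/allP => g d_g; have lt_g : g < 6 := lt_d g d_g.
rewrite -(face_index_nth (is_perm_lt (inverse_perm r_col) lt_g)).
set f := nth _ faces _; have def_g : face_index (rotate r f) = g.
  rewrite -nth_face_table face_index_nth ?(is_perm_lt (inverse_perm r_col)) //.
  rewrite -nth_compose ?(is_perm_size (inverse_perm r_col)) //.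
  by rewrite (compose_inverse r_col) nth_iota.
by rewrite -def_g !nth_coloring_of; apply: (implyP (r_ok f)); rewrite on_d def_g.
Qed.

(** * The frame *)

Definition coordinate (d : seq nat) (a : nat) : nat :=
  if 2 * a \in d then 0 else if (2 * a).+1 \in d then 2 else 1.

Definition pos_of (d : seq nat) : position 3 :=
  [ffun a : 'I_3 => inord (coordinate d a)].

Lemma pos_ofE d a : pos_of d a = coordinate d a :> nat.
Proof. by rewrite ffunE inordK // /coordinate; do 2?case: ifP. Qed.

Lemma on_face_pos_of d f : d \in corners ++ edges ->
  on_face (pos_of d) f = (face_index f \in d).
Proof.
have checked : all (fun d => all (fun a =>
    ((coordinate d a == 0) == (2 * a \in d))
    && ((coordinate d a == 2) == ((2 * a).+1 \in d))) (iota 0 3)) (corners ++ edges).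
  by [].
move=> /(allP checked)/all_iotaP on_d; case: f => a b.
have /andP[/eqP on0 /eqP on2] := on_d a (ltn_ord a).
by rewrite /on_face pos_ofE /face_index; case: b; rewrite /= ?addn1 ?addn0.
Qed.

Lemma pos_of_inj : {in corners ++ edges &, injective pos_of}.
Proof.
have checked : all (fun d => all (fun d' =>
    all (fun a => coordinate d a == coordinate d' a) (iota 0 3) ==> (d == d'))
  (corners ++ edges)) (corners ++ edges) by compute_true.
move=> d d' d_in d'_in eq_pos; apply/eqP.
apply: (implyP (allP (allP checked d d_in) d' d'_in)).
by apply/all_iotaP => a lt_a; rewrite -[a]/(val (Ordinal lt_a)) -!pos_ofE eq_pos.
Qed.

Lemma pos_of_frame d : d \in corners ++ edges -> pos_of d \in frame 3.
Proof.
have checked : all (fun d => let f := nth 0 d 0 in let g := nth 0 d 1 in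
    [&& f \in d, g \in d, f < 6, g < 6 & f./2 != g./2]) (corners ++ edges) by [].
move=> d_in; have /and5P[d_f d_g lt_f lt_g neq_fg] := allP checked d d_in.
rewrite inE; apply/existsP; exists (nth (axis0, false) faces (nth 0 d 0)).
apply/existsP; exists (nth (axis0, false) faces (nth 0 d 1)).
rewrite !on_face_pos_of // !face_index_nth // d_f d_g !andbT.
have half_index h : (face_index h)./2 = h.1 by rewrite /face_index; lia.
apply: contra neq_fg => /eqP eq_axis; rewrite -(face_index_nth lt_f).
by rewrite -(face_index_nth lt_g) !half_index eq_axis.
Qed.

Lemma frame_pos_of x : x \in frame 3 ->
  exists2 d, d \in corners ++ edges & x = pos_of d.
Proof.
rewrite inE => /existsP[f /existsP[g /and3P[neq_fg x_f x_g]]].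
have outer (h : face) : on_face x h -> x h.1 != 1 :> nat by move/eqP->; case: h.2.
have checked : all (fun t0 => all (fun t1 => all (fun t2 =>
     (count_mem 1 [:: t0; t1; t2] <= 1) ==>
     has (fun d => [seq coordinate d a | a <- iota 0 3] == [:: t0; t1; t2])
       (corners ++ edges)) (iota 0 3)) (iota 0 3)) (iota 0 3) by [].
have le1 : count_mem 1 [:: x axis0 : nat; x axis1 : nat; x axis2 : nat] <= 1.
  move: neq_fg (outer f x_f) (outer g x_g).
  by case: (axisP f.1) => ->; case: (axisP g.1) => -> //= _ /negPf-> /negPf->;
     rewrite ?addn0 ?add0n ?leq_b1.
have := all_iota2P _ _ _ checked _ _ (ltn_ord (x axis0)) (ltn_ord (x axis1)).
move=> /all_iotaP/(_ _ (ltn_ord (x axis2)))/implyP/(_ le1)/hasP[d d_in /eqP[e0 e1 e2]].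
exists d => //; apply/ffunP => a; apply: val_inj; rewrite [RHS]pos_ofE.
by case: (axisP a) => ->; rewrite /= ?e0 ?e1 ?e2.
Qed.

Definition can_fill (N n : nat) (c : 'I_N -> colored_cube) (big : colored_cube)
  (x : position n) (i : 'I_N) : bool := [exists r, matches (c i) big x r].

Lemma buildable_hall N n (c : 'I_N -> colored_cube) : frame_buildable n c ->
  exists big, hall (can_fill c big) (frame n).
Proof.
case=> big [sel [rot [inj_sel ok]]]; exists big; apply: (@matching_hall _ _ _ _ sel).
split=> // x frame_x; apply/existsP; exists (rot x); apply/forallP => g.
by apply/implyP => on_g; apply/eqP/ok.
Qed.

Lemma hall_buildable N n (c : 'I_N.+1 -> colored_cube) big :
  hall (can_fill c big) (frame n) -> frame_buildable n c.
Proof.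
case/(matching_exists ord0) => sel [inj_sel fill].
have [r0 _] : exists r0, face_table r0 = iota 0 6 by apply: rotation_of_table.
have rotation_at x : exists r, x \in frame n -> matches (c (sel x)) big x r.
  have [/fill/existsP[r r_ok]|_] := boolP (x \in frame n); last by exists r0.
  by exists r.
have [rot rotP] := fin_all_exists rotation_at.
exists big, sel, rot; split=> // x g /rotP/forallP/(_ g)/implyP + on_g.
by move/(_ on_g)/eqP.
Qed.

Section Frame3.

Variables (N : nat) (c : 'I_N -> colored_cube).

Definition variety_at (i : 'I_N) : nat := variety_of (coloring_of (c i)).
Definition varieties_in : seq nat := [seq variety_at i | i <- enum 'I_N].

Lemma varieties_in_lt : all (gtn 30) varieties_in.
Proof. by apply/allP => _ /mapP[i _ ->]; apply/variety_of_lt/coloring_ofP. Qed.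

Lemma size_varieties_in : size varieties_in = N.
Proof. by rewrite size_map size_enum_ord. Qed.

Lemma count_varieties_in (P : pred nat) :
  count P varieties_in = #|[set i | P (variety_at i)]|.
Proof. by rewrite count_map -size_filter cardsE cardE {1}enumT. Qed.

Lemma can_fill_pos_of big d i : d \in corners ++ edges ->
  can_fill c big (pos_of d) i
    = placeable (variety (variety_at i)) (coloring_of big) d.
Proof.
move=> d_in; have lt_d := cells_lt d_in.
rewrite placeable_variety_of ?coloring_ofP //.
have on_d f : on_face (pos_of d) f = (face_index f \in d) by apply: on_face_pos_of.
exact/existsP/(placeableP (c i) big on_d lt_d).
Qed.

Lemma card_neighbors_cells big D : subseq D (corners ++ edges) ->
  #|neighbors (can_fill c big) [set x in map pos_of D]|
    = count (fits (coloring_of big) D) varieties_in.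
Proof.
move=> /mem_subseq sub_D; rewrite count_varieties_in; apply: eq_card => i.
rewrite [RHS]inE; apply/neighborsP/hasP => [[x]|[d D_d fit]].
  rewrite inE => /mapP[d D_d ->]; rewrite can_fill_pos_of ?sub_D // => fit.
  by exists d.
by exists (pos_of d); rewrite ?inE ?map_f // can_fill_pos_of ?sub_D.
Qed.

Lemma card_cells D : subseq D (corners ++ edges) -> #|[set x in map pos_of D]| = size D.
Proof.
move=> sub_D; rewrite cardsE -(size_map pos_of); apply/card_uniqP.
rewrite map_inj_in_uniq ?(subseq_uniq sub_D) // => d d' D_d D_d'.
by apply: pos_of_inj; apply: (mem_subseq sub_D).
Qed.

Lemma hall_frame3 big : hall (can_fill c big) (frame 3) <->
  fillable (corners ++ edges) varieties_in (coloring_of big).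
Proof.
split=> [hall_c D sub_D|fill A sub_A].
  rewrite -card_cells // -card_neighbors_cells //; apply: hall_c.
  apply/subsetP => x; rewrite inE => /mapP[d D_d ->]; apply: pos_of_frame.
  exact: mem_subseq sub_D d D_d.
pose D := [seq d <- corners ++ edges | pos_of d \in A].
have sub_D : subseq D (corners ++ edges) := filter_subseq _ _.
have ->: A = [set x in map pos_of D].
  apply/setP => x; rewrite inE; apply/idP/mapP => [A_x|[d]].
    have [d d_in def_x] := frame_pos_of (subsetP sub_A x A_x).
    by exists d; rewrite // mem_filter -def_x A_x.
  by rewrite mem_filter => /andP[A_d _] ->.
by rewrite card_cells // card_neighbors_cells //; apply: fill.
Qed.

End Frame3.

Theorem frame3_buildable_24 : frame_always_buildable 3 24.
Proof.
move=> c.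
have [q q_col fill] := exists_fillable (varieties_in_lt c) (size_varieties_in c).
have [big def_q] := cube_of_coloring q_col.
by apply: (@hall_buildable _ _ _ big); apply/hall_frame3; rewrite def_q.
Qed.

(** * Twenty-three cubes do not suffice *)

(* The varieties 0, 11, 15, 20 and 26 pairwise share no corner. *)
Definition extremal : seq nat := nseq 7 0 ++ nseq 7 11 ++ nseq 7 15 ++ [:: 20; 26].

(* Hall's condition fails for all corners if the big cube has one of the five
   varieties, and otherwise for the corners that none of the three frequent
   varieties has. *)
Lemma extremal_not_fillable q : coloring q -> ~ fillable corners extremal q.
Proof.
pose missing q := [seq d <- corners | ~~ has (fun V => placeable (variety V) q d)
                                              [:: 0; 11; 15]].
have checked : all (fun q => has (fun D => count (fits q D) extremal < size D)
  [:: corners; missing q]) colorings by compute_true.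
move=> q_col fill; have /hasP[D D_in] := all_coloringsP checked q_col.
have sub_D : subseq D corners.
  move: D_in; rewrite mem_seq2 => /orP[]/eqP->; first exact: subseq_refl.
  exact: filter_subseq.
by move/(leq_ltn_trans (fill D sub_D)); rewrite ltnn.
Qed.

Lemma varieties_in_exists (s : seq nat) M : all (gtn 30) s -> M <= size s ->
  exists c : 'I_M -> colored_cube, varieties_in c = take M s.
Proof.
move=> s_lt le_M; have lt_nth (i : 'I_M) : nth 0 s i < 30.
  by apply: (allP s_lt); rewrite mem_nth // (leq_trans (ltn_ord i)).
have [c cP] := fin_all_exists (fun i => cube_of_coloring (variety_coloring (lt_nth i))).
exists c; rewrite -(map_nth_iota0 0 le_M) -val_enum_ord -map_comp.
apply: eq_map => i /=.
by rewrite /variety_at cP variety_of_variety.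
Qed.

Theorem frame3_ge24 M : frame_always_buildable 3 M -> 24 <= M.
Proof.
move=> build; rewrite leqNgt; apply/negP => lt_M.
have [c def_c] := @varieties_in_exists extremal M isT lt_M.
have [big /hall_frame3 fill] := buildable_hall (build c).
apply: (extremal_not_fillable (coloring_ofP big)) => D sub_D.
apply: leq_trans (fill D _) _; first exact: subseq_trans sub_D (prefix_subseq _ _).
by rewrite def_c leq_count_subseq ?take_subseq.
Qed.

Theorem theoremA : frame_always_buildable 3 24 /\ is_fr 3 24.
Proof.
split; first exact: frame3_buildable_24.
by split; [exact: frame3_buildable_24 | exact: frame3_ge24].
Qed.
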